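(* Let $m,n\in\mathbb{R}^+\cup\{0\}$ and $f\in D_{HK}$. Then (i) $\mathcal{J}_a^m\mathcal{J}_a^nf=\mathcal{J}_a^{m+n}f$ in $D_{HK}$; moreover, if $m\geq1$ or $n\geq 1$, the identity holds at every point of $[a,b]$ as an identity of continuous functions; (ii) $\mathcal{J}_a^m\mathcal{J}_a^nf=\mathcal{J}_a^n\mathcal{J}_a^mf$ in $D_{HK}$; (iii) the set $\{\mathcal{J}_a^n:D_{HK}\to D_{HK},\ n\geq0\}$ forms a commutative semigroup with respect to composition, with the identity operator $\mathcal{J}_a^0$ as neutral element.
   Context: Fix real numbers $a<b$. $\mathcal{D}(a,b)$ is the space of real $C^\infty$ functions with compact support in $(a,b)$, $\mathcal{D}'(a,b)$ the space of distributions on $(a,b)$, $D$ the distributional derivative. Let $C_0=\{F\in C[a,b]:F(a)=0\}$. A distribution $f\in\mathcal{D}'(a,b)$ is Henstock–Kurzweil integrable if there is $F\in C_0$ with $DF=f$ (such $F$ is unique, the primitive of $f$), and its distributional Henstock–Kurzweil integral is $\int_c^d f=F(d)-F(c)$. $D_{HK}$ is the space of these distributions with the Alexiewicz norm $\|f\|_A=\sup_{x\in[a,b]}|F(x)|$; it is a Banach space containing $L^1[a,b]$ as a dense subspace. Riemann–Liouville fractional integral on $D_{HK}$: for $n\ge 1$, $\mathcal{J}_a^nf(x)=\frac{1}{\Gamma(n)}\int_a^x(x-t)^{n-1}f(t)\,dt$ for $a\le x\le b$ (distributional Henstock–Kurzweil integral; for $n\ge1$ this is a continuous function on $[a,b]$);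 for $0<n<1$, $\mathcal{J}_a^nf(x)=\frac{1}{\Gamma(n)}\lim_{k\to\infty}\int_a^x(x-t)^{n-1}f_k(t)\,dt$, where $(f_k)\subset L^1[a,b]$ with $\|f_k-f\|_A\to0$; $\mathcal{J}_a^0$ is the identity. These operators map $D_{HK}$ into $D_{HK}$. *)

(* Defs.v *)
From mathcomp Require Import all_boot all_order all_algebra.
From mathcomp Require Import all_classical all_reals all_analysis.
Import Order.TTheory GRing.Theory Num.Theory.
Import numFieldNormedType.Exports.
Set Implicit Arguments. Unset Strict Implicit. Unset Printing Implicit Defensive.
Local Open Scope classical_set_scope.
Local Open Scope ring_scope.

Section HK.
Variable R : realType.
Variables a b : R.

Local Notation mu := (@lebesgue_measure R).

Definition test_fun (phi : R -> R) : Prop :=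
  (forall (k : nat) (x : R), derivable (derive1n k phi) x 1) /\
  exists c d : R, [/\ a < c, c <= d, d < b &
                      forall x, x < c \/ d < x -> phi x = 0].

Definition distr := (R -> R) -> R.

Definition is_distribution (T : distr) : Prop :=
  [/\ (forall phi psi, test_fun phi -> test_fun psi ->
         T (phi \+ psi) = T phi + T psi),
      (forall (c : R) phi, test_fun phi -> T (fun x => c * phi x) = c * T phi) &
      (forall c d, a < c -> d < b ->
         exists (C : R) (N : nat), forall phi, test_fun phi ->
           (forall x, x < c \/ d < x -> phi x = 0) ->
           `|T phi| <= C * \sum_(k < N.+1)
                              sup (range (fun x => `|derive1n k phi x|)))].

Definition distr_eq (S T : distr) : Prop := forall phi, test_fun phi -> S phi = T phi.

Definition in_C0 (F : R -> R) : Prop := {within `[a, b], continuous F} /\ F a = 0.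

Definition Ddistr (F : R -> R) : distr :=
  fun phi => - (\int[mu]_(x in `[a, b]) (F x * derive1 phi x)).

Definition is_primitive (f : distr) (F : R -> R) : Prop :=
  in_C0 F /\ distr_eq (Ddistr F) f.

Definition DHK (f : distr) : Prop :=
  is_distribution f /\ exists F, is_primitive f F.

(** The (unique on [a,b]) primitive of f in D_HK. *)
Definition primitive (f : distr) : R -> R := xget (fun _ => 0) (is_primitive f).

Definition hk_integral (f : distr) (c d : R) : R := primitive f d - primitive f c.

Definition alex_norm (f : distr) : R :=
  sup [set `|primitive f x| | x in `[a, b]].

Definition distr_sub (f g : distr) : distr := fun phi => f phi - g phi.

Definition regdist (g : R -> R) : distr :=
  fun phi => \int[mu]_(x in `[a, b]) (g x * phi x).

Definition L1 (g : R -> R) : Prop := mu.-integrable `[a, b] (EFin \o g).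

Definition Gamma (s : R) : R :=
  \int[mu]_(t in `]0%R, +oo[) (t `^ (s - 1) * expR (- t)).

(** Integral of the product of f in D_HK with an absolutely continuous
    (hence BV) function g over [a,x], defined (as in the multiplier theory
    for D_HK) by integration by parts:
      int_a^x f g = F(x) g(x) - int_a^x F dg,  with dg = g'(t) dt. *)
Definition hk_int_mul (f : distr) (g : R -> R) (x : R) : R :=
  primitive f x * g x - \int[mu]_(t in `[a, x]) (primitive f t * derive1 g t).

Definition RLfun (n : R) (f : distr) (x : R) : R :=
  (Gamma n)^-1 * hk_int_mul f (fun t => (x - t) `^ (n - 1)) x.

Definition RLcl (n : R) (g : R -> R) (x : R) : R :=
  if n == 0 then g x
  else (Gamma n)^-1 * \int[mu]_(t in `[a, x]) ((x - t) `^ (n - 1) * g t).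

Definition RLlow (n : R) (f : distr) : distr :=
  xget (fun _ => 0)
    (fun h : distr => DHK h /\
       forall fk : nat -> R -> R, (forall k, L1 (fk k)) ->
         (fun k => alex_norm (distr_sub (regdist (fk k)) f)) @ \oo --> 0 ->
         (fun k => alex_norm (distr_sub (regdist (RLcl n (fk k))) h)) @ \oo --> 0).

Definition RL (n : R) (f : distr) : distr :=
  if n == 0 then f
  else if 1 <= n then regdist (RLfun n f)
  else RLlow n f.

End HK.

(* Main.v *)
(** Let [F] be the primitive of [f].  Integration by parts turns [J^n f], for [n >= 1],
    into the classical fractional integral [J^(n-1) F] of a continuous function, and for
    every [n >= 0] the primitive of [J^n f] is [J^n F].  Distributions in [D_HK] being
    determined by their primitives (du Bois-Reymond), all claims reduce to the identity
    [J^m J^n F = J^(m+n) F] for continuous [F].  By Fubini it follows from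
    [K_m * K_n = K_(m+n)] for the kernels [K_n(u) = u^(n-1) / Gamma n] on [u > 0].
    For [0 < n < 1] the same Fubini argument on L^1 gives
    [J^1 (J^n g) = J^n (J^1 g)], whence [J^n] is Lipschitz for the Alexiewicz norm. *)

Require Import Defs.
From HB Require Import structures.
From mathcomp Require Import all_boot all_order all_algebra.
From mathcomp Require Import all_classical all_reals all_analysis.
From mathcomp Require Import measurable_realfun ring lra.
Import Order.TTheory GRing.Theory Num.Theory.
Import numFieldNormedType.Exports.
Local Open Scope classical_set_scope.
Local Open Scope ring_scope.
Set Implicit Arguments.
Unset Strict Implicit.
Unset Printing Implicit Defensive.

(** * Gamma function and fractional kernels *)

(** Real integrals are the finite parts of extended ones, so an infinite integral silently becomes
    $0$. Hence the kernel identities are proved for non-negative extended-valued integrals over the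
    whole line, with the limits of integration encoded as supports, and finiteness is deduced
    afterwards. Since $K_1$ is the indicator of $u > 0$, truncations to half-lines, antiderivatives
    and dominating functions are all instances of $K_m * K_n = K_{m+n}$; that $K_1$ vanishes at $0$
    accounts for the recurring base points $a - 1$ and $b + 1$. For $0 < n < 1$ the kernel is
    singular and the operator on distributions is only a choice of an object satisfying a limit
    condition. A candidate must be exhibited before the choice means anything, and it must be the
    only one. Both rest on approximating $F$ uniformly by indefinite integrals $J^1 f$ with $f$
    continuous: this makes $J^n F$ continuous, so that its derivative is a candidate, and it
    supplies an $L^1$ sequence along which any two candidates agree. *)

Section affine_change_of_variables.
Context {R : realType}.
Local Notation mu := (@lebesgue_measure R).
Implicit Types (a c : R) (f : R -> \bar R).

Lemma measurable_affine a c : measurable_fun setT (fun x : R => a * x + c).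
Proof. by apply: measurable_funD => //; exact: measurable_funM. Qed.

(** Lebesgue measure is determined by its values on intervals $]u,v]$, so the scaled image measure
    need only be compared there. A negative slope turns the preimage into a left-closed interval,
    whence the two cases. *)
Lemma lebesgue_measure_affine a c (A : set R) : a != 0 -> measurable A ->
  (mu A = `|a|%R%:E * mu ((fun x => (a * x + c)%R) @^-1` A))%E.
Proof.
move=> a0 mA.
pose phi := (fun x : R => a * x + c) : measurableTypeR R -> measurableTypeR R.
have mphi : measurable_fun setT phi := measurable_affine a c.
pose mix := isMeasurableFun.Build _ _ _ _ _ mphi.
pose phi' : {mfun measurableTypeR R >-> measurableTypeR R} := HB.pack phi mix.
pose na : {nonneg R} := NngNum (normr_ge0 a).
have := @lebesgue_measure_unique R (mscale na (pushforward mu phi')) _ A mA.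
apply => X [[u v] _ <-].
change (mu `]u, v]%classic = `|a|%:E * mu (phi @^-1` `]u, v]%classic))%E.
have [an|ap] := ltP a 0.
  have -> : phi @^-1` `]u, v] = `[(v - c) / a, (u - c) / a[%classic.
    apply/seteqP; split=> x /=; rewrite !in_itv/= /phi;
    rewrite ler_ndivrMr// ltr_ndivlMr// (mulrC x) => /andP[h1 h2];
    apply/andP; split; lra.
  rewrite !lebesgue_measure_itv/= !lte_fin ltr_nM2r ?invr_lt0//.
  rewrite ltrD2r; case: ifPn => uv; last by rewrite mule0.
  by rewrite -!EFinB -EFinM ltr0_norm//; congr EFin; field; rewrite lt_eqF.
have {}ap : 0 < a by rewrite lt_neqAle eq_sym a0.
have -> : phi @^-1` `]u, v] = `](u - c) / a, (v - c) / a]%classic.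
  apply/seteqP; split=> x /=; rewrite !in_itv/= /phi;
  rewrite ler_pdivlMr// ltr_pdivrMr// (mulrC x) => /andP[h1 h2];
  apply/andP; split; lra.
rewrite !lebesgue_measure_itv/= !lte_fin ltr_pM2r ?invr_gt0//.
rewrite ltrD2r; case: ifPn => uv; last by rewrite mule0.
by rewrite -!EFinB -EFinM gtr0_norm//; congr EFin; field.
Qed.

(** Stated for non-negative extended functions so that a substitution can be made before the
    integral is known to be finite. *)
Lemma ge0_integral_affine a c f : a != 0 -> measurable_fun setT f ->
  (forall x, 0 <= f x)%E ->
  (\int[mu]_x f x = `|a|%R%:E * \int[mu]_x f (a * x + c)%R)%E.
Proof.
move=> a0 mf f0.
pose phi := (fun x : R => a * x + c) : measurableTypeR R -> measurableTypeR R.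
have mphi : measurable_fun setT phi := measurable_affine a c.
pose mix := isMeasurableFun.Build _ _ _ _ _ mphi.
pose phi' : {mfun measurableTypeR R >-> measurableTypeR R} := HB.pack phi mix.
pose na : {nonneg R} := NngNum (normr_ge0 a).
rewrite (eq_measure_integral (mscale na (pushforward mu phi'))); last first.
  by move=> A mA _; apply: lebesgue_measure_affine.
rewrite ge0_integral_mscale//; congr (_ * _)%E.
by rewrite ge0_integral_pushforward//= preimage_setT.
Qed.

Lemma ge0_integral_shift c f : measurable_fun setT f -> (forall x, 0 <= f x)%E ->
  (\int[mu]_x f x = \int[mu]_x f (x + c)%R)%E.
Proof.
move=> mf f0; rewrite (@ge0_integral_affine 1 c)// ?oner_neq0//.
by rewrite normr1 mul1e; apply: eq_integral => x _; rewrite mul1r.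
Qed.

End affine_change_of_variables.

(** * Finiteness and positivity of the Gamma integral *)

Section gamma_function.
Context {R : realType}.
Local Notation mu := (@lebesgue_measure R).
Implicit Types (n c e u x : R).

Lemma continuous_powR_gt0 n x : 0 < x -> {for x, continuous (@powR R ^~ n)}.
Proof.
move=> x0; apply: differentiable_continuous; apply/derivable1_diffP.
by have := is_derive1_powR n x0 => -[].
Qed.

Lemma integral_powR_cc n e c : 0 < n -> 0 < e -> e < c ->
  (\int[mu]_(x in `[e, c]) (x `^ (n - 1))%:E =
   (c `^ n / n)%:E - (e `^ n / n)%:E)%E.
Proof.
move=> n0 e0 ec.
have gt0 x : x \in `[e, c] -> 0 < x.
  by rewrite in_itv/= => /andP[/(lt_le_trans e0)].
have cpow m x : x \in `[e, c] -> {for x, continuous (@powR R ^~ m)}.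
  by move=> /gt0; exact: continuous_powR_gt0.
have drv x : 0 < x -> is_derive x 1 (fun x => x `^ n / n) (x `^ (n - 1)).
  move=> x0; have h : is_derive x 1 (@powR R ^~ n) (n * x `^ (n - 1))%R.
    exact: is_derive1_powR.
  have -> : (fun x => x `^ n / n) = n^-1 *: (@powR R ^~ n).
    by apply/funext => y; rewrite mulrC.
  apply: is_derive_eq; rewrite /GRing.scale/= mulrA mulVf ?mul1r//.
  by rewrite gt_eqF.
have cont x : 0 < x -> {for x, continuous (fun x => x `^ n / n)}.
  move=> x0; apply: differentiable_continuous; apply/derivable1_diffP.
  by have [] := drv _ x0.
apply: (@continuous_FTC2 _ _ (fun x => x `^ n / n)) => //.
- apply: continuous_in_subspaceT => x; rewrite inE/= => xec; exact: cpow.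
- split.
  + by move=> x /subset_itv_oo_cc /gt0 /drv[].
  + by apply: cvg_at_right_filter; apply: cont.
  + by apply: cvg_at_left_filter; apply: cont; exact: lt_trans ec.
- move=> x /subset_itv_oo_cc /gt0 x0; rewrite derive1E.
  by have [_ ->] := drv _ x0.
Qed.

Lemma measurable_fun_powR_subr n :
  measurable_fun setT (fun x : R => (x `^ (n - 1))%:E).
Proof. by apply/measurable_EFinP; exact: measurable_powR. Qed.

(** For $n < 1$ the integrand is singular at $0$, so the fundamental theorem is applied on segments
    away from $0$ and the result follows by monotone convergence. *)
Lemma integral_powR_oc n c : 0 < n -> 0 < c ->
  (\int[mu]_(x in `]0%R, c]) (x `^ (n - 1))%:E = (c `^ n / n)%:E)%E.
Proof.
move=> n0 c0.
(* [k.+2] keeps the left end strictly below [c], as [integral_powR_cc] requires. *)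
pose F (k : nat) := `[c / k.+2%:R, c]%classic.
have FU : \bigcup_k F k = `]0, c]%classic.
  apply/seteqP; split=> [x [k _]|x]; rewrite /F/= !in_itv/= => /andP[x0 xc].
    by rewrite xc andbT (lt_le_trans _ x0)// divr_gt0.
  have [k Hk] : exists k : nat, c / x < k.+2%:R.
    exists (Num.truncn (c / x)); rewrite (lt_trans (truncnS_gt _))//.
    by rewrite ltr_nat.
  exists k => //=; rewrite in_itv/= xc andbT ler_pdivrMr//.
  by move: Hk; rewrite ltr_pdivrMr// mulrC => /ltW.
have h : (\int[mu]_(x in F k) (x `^ (n - 1))%:E @[k --> \oo] -->
          \int[mu]_(x in `]0%R, c]) (x `^ (n - 1))%:E)%E.
  rewrite -FU; apply: ge0_nondecreasing_set_cvg_integral.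
  - move=> i j ij; apply/subsetPset; rewrite /F; apply: subset_itvr.
    by rewrite bnd_simp ler_pM2l// lef_pV2 ?posrE// ler_nat !ltnS.
  - by move=> k; exact: measurable_itv.
  - by move=> k; apply: measurable_funTS; exact: measurable_fun_powR_subr.
  - by move=> k x _; rewrite lee_fin powR_ge0.
apply/esym/(cvg_unique _ _ h) => //.
rewrite (_ : (fun i => _) = (fun k : nat =>
  (c `^ n / n - (c / k.+2%:R) `^ n / n)%:E)); last first.
  apply/funext => k; rewrite /F integral_powR_cc// ?divr_gt0//.
  by rewrite ltr_pdivrMr// ltr_pMr// ltr1n.
apply: cvg_EFin; first exact: nearW.
have dcvg : (c / k.+2%:R) @[k --> \oo] --> (0 : R).
  rewrite -[X in _ --> X](mulr0 c); apply: cvgM; first exact: cvg_cst.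
  by have := @cvg_harmonic R; rewrite -(cvg_shiftS (@harmonic R)); exact.
have pcvg : ((c / k.+2%:R) `^ n) @[k --> \oo] --> (0 : R).
  apply: (@cvg_comp _ _ _ _ (@powR R ^~ n) _ (0^'+) _ _ (powR_cvg0 n0)).
  move=> P; rewrite /at_right/within/= => nP.
  by move/dcvg: nP => [N _ HN]; exists N => // k /HN /=; apply; exact: divr_gt0.
suff : (c `^ n / n - (c / k.+2%:R) `^ n / n) @[k --> \oo] -->
       c `^ n / n - 0 / n by rewrite mul0r subr0.
apply: cvgB; first exact: cvg_cst.
by apply: cvgM; [exact: pcvg|exact: cvg_cst].
Qed.

(* The cut-off is explicit because [u `^ p] is [1], not [0], for [u < 0]. *)
Definition pow_kernel n u : R := if 0 < u then u `^ (n - 1) else 0.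

Lemma pow_kernel_ge0 n u : 0 <= pow_kernel n u.
Proof. by rewrite /pow_kernel; case: ifP => // _; exact: powR_ge0. Qed.

Lemma measurable_pow_kernel n : measurable_fun setT (pow_kernel n).
Proof.
have -> : pow_kernel n = (@powR R ^~ (n - 1)) \_ `]0, +oo[.
  by apply/funext => u; rewrite patchE mem_setE in_itv/= andbT.
apply/(measurable_restrictT _ _).1 => //.
by apply: measurable_funTS; exact: measurable_powR.
Qed.

(** Raise $y \le e^y$ at $y = x/(2n)$ to the power $n$. Half of the exponential decay thus absorbs
    any power. *)
Lemma powR_le_expR_half n x : 0 < n -> 0 <= x ->
  x `^ n <= (2 * n) `^ n * expR (x / 2).
Proof.
move=> n0 x0.
have n20 : 0 < 2 * n by rewrite mulr_gt0.
have h : x / (2 * n) <= expR (x / (2 * n)).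
  by apply: le_trans (expR_ge1Dx _); rewrite lerDr.
have -> : x / 2 = (x / (2 * n)) * n by field; rewrite gt_eqF.
rewrite expRM -powRM ?expR_ge0//; last exact: ltW.
apply: ge0_ler_powR => //.
- exact: ltW.
- by rewrite nnegrE mulr_ge0 ?expR_ge0// ltW.
- by rewrite mulrC -ler_pdivrMr.
Qed.

(** The integrand is dominated by $x^{n-1}$ on $]0,1]$ and by a multiple of the exponential density
    of rate $1/2$ beyond. *)
Lemma integrable_gamma n : 0 < n ->
  mu.-integrable setT (fun x => (pow_kernel n x * expR (- x))%:E).
Proof.
move=> n0.
(* A positive exponent at least $n - 1$, since $n - 1$ itself may be negative. *)
pose p := `|n - 1| + 1.
have p0 : 0 < p by rewrite ltr_wpDl.
(* The last factor cancels the rate $1/2$ in front of the density. *)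
pose C := (2 * p) `^ p * 2.
pose g1 := (fun x : R => x `^ (n - 1)) \_ `]0, 1].
pose g2 := fun x => C * exponential_pdf (2^-1 : R) x.
have mpow : measurable_fun setT (fun x => pow_kernel n x * expR (- x)).
  apply: measurable_funM; first exact: measurable_pow_kernel.
  by apply: measurableT_comp => //; exact: measurable_expR.
have i1 : mu.-integrable setT (EFin \o g1).
  rewrite -restrict_EFin; apply/integrable_restrict => //; rewrite setTI.
  apply/integrableP; split.
    by apply: measurable_funTS; exact: measurable_fun_powR_subr.
  under eq_integral do rewrite /= ger0_norm ?powR_ge0//.
  by rewrite integral_powR_oc// ltry.
have i2 : mu.-integrable setT (EFin \o g2).
  have -> : EFin \o g2 = (fun x => C%:E * (EFin \o exponential_pdf 2^-1) x)%E.
    by [].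
  by apply: integrableZl => //; apply: integrable_exponential_pdf; lra.
apply: le_integrable (integrableD _ i1 i2) => //.
  exact/measurable_EFinP.
move=> x _ /=; rewrite lee_fin.
have C0 : 0 <= C by apply: mulr_ge0 => //; exact: powR_ge0.
have g10 : 0 <= g1 x.
  by rewrite /g1 patchE; case: ifPn => // _; exact: powR_ge0.
have g20 : 0 <= g2 x.
  by apply: mulr_ge0 => //; apply: exponential_pdf_ge0; lra.
have pk0 : 0 <= pow_kernel n x * expR (- x).
  by rewrite mulr_ge0 ?expR_ge0 ?pow_kernel_ge0.
rewrite (ger0_norm pk0) (ger0_norm (addr_ge0 g10 g20)).
rewrite /pow_kernel; case: ltP => x0; last by rewrite mul0r addr_ge0.
have [x1|x1] := leP x 1.
  rewrite -[leLHS]addr0 lerD// /g1 patchE ifT ?inE/= ?in_itv/= ?x0//.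
  by rewrite ler_piMr ?powR_ge0// expR_le1 oppr_le0 ltW.
rewrite -[leLHS]add0r lerD// /g2 (exponential_pdfE _ (ltW x0)).
have -> : - x = - (2^-1) * x - x / 2 by field.
rewrite expRD mulrCA (_ : C * _ = expR (- 2^-1 * x) * (2 * p) `^ p); last first.
  by rewrite /C; field.
rewrite ler_wpM2l ?expR_ge0//.
rewrite expRN -ler_pdivlMr ?invr_gt0 ?expR_gt0// invrK.
apply: (le_trans _ (powR_le_expR_half p0 (ltW x0))).
apply: ler_powR; [exact: ltW|rewrite /p].
by rewrite (le_trans (ler_norm _))// lerDl.
Qed.

Lemma EFin_Gamma n : 0 < n ->
  (\int[mu]_x (pow_kernel n x * expR (- x))%:E = (Gamma n)%:E)%E.
Proof.
move=> n0; rewrite /Gamma /Rintegral fineK.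
  rewrite integral_mkcond; apply: eq_integral => x _.
  rewrite patchE /pow_kernel mem_setE in_itv/= andbT.
  by case: ifP => // _; rewrite mul0r.
apply: integrable_fin_num => //.
have : mu.-integrable `]0, +oo[ (fun x => (pow_kernel n x * expR (- x))%:E).
  by apply: integrableS (integrable_gamma n0).
apply: eq_integrable; first exact: measurable_itv.
by move=> x; rewrite inE/= in_itv/= andbT /pow_kernel => ->.
Qed.

(** On $]0,1]$ the factor $e^{-t}$ is at least $e^{-1}$, and the power there has integral $1/n$. *)
Lemma Gamma_gt0 n : 0 < n -> 0 < Gamma n.
Proof.
move=> n0; rewrite -lte_fin -EFin_Gamma//.
have c0 : (0 < (\int[mu]_(x in `]0%R, 1%R]) (x `^ (n - 1) * expR (-1))%:E))%E.
  under eq_integral do rewrite EFinM.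
  rewrite ge0_integralZr//.
  - by rewrite integral_powR_oc// -EFinM lte_fin mulr_gt0 ?expR_gt0// powR1 divr_gt0.
  - by apply: measurable_funTS; exact: measurable_fun_powR_subr.
  - by move=> x _; rewrite lee_fin powR_ge0.
apply: (lt_le_trans c0); rewrite [X in (X <= _)%E]integral_mkcond.
apply: ge0_le_integral => //.
- by move=> x _; rewrite patchE; case: ifP => // _;
    rewrite lee_fin mulr_ge0 ?powR_ge0 ?expR_ge0.
- apply/(measurable_restrictT _ _).1 => //; apply: measurable_funTS.
  by apply/measurable_EFinP; apply: measurable_funM => //; exact: measurable_powR.
- apply/measurable_EFinP.
  apply: measurable_funM; first exact: measurable_pow_kernel.
  by apply: measurableT_comp => //; exact: measurable_expR.
- move=> x _; rewrite !patchE mem_setE in_itv/= /pow_kernel.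
  case: ifPn => [/andP[x0 x1]|_].
    by rewrite x0 lee_fin ler_wpM2l ?powR_ge0// ler_expR lerN2.
  by rewrite lee_fin mulr_ge0 ?expR_ge0//; case: ifP => // _; exact: powR_ge0.
Qed.

(** The integrand is the exponential density of rate $1$ except at the point $0$, where the cut-off
    kernel vanishes and the density does not. *)
Lemma Gamma1 : Gamma (1 : R) = 1.
Proof.
apply: EFin_inj; rewrite -EFin_Gamma// -[RHS](@integral_exponential_pdf R 1)//.
apply: ge0_ae_eq_integral => //.
- apply/measurable_EFinP.
  apply: measurable_funM; first exact: measurable_pow_kernel.
  by apply: measurableT_comp => //; exact: measurable_expR.
- apply/measurable_EFinP; exact: measurable_exponential_pdf.
- by move=> x _; rewrite lee_fin mulr_ge0 ?pow_kernel_ge0 ?expR_ge0.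
- by move=> x _; rewrite lee_fin exponential_pdf_ge0.
exists [set 0 : R]; split; [exact: measurable_set1|exact: lebesgue_measure_set1|].
move=> x /=; apply: contra_notP => /eqP x0 _.
rewrite /pow_kernel subrr powRr0.
have [x0'|x0'] := ltP 0 x.
  by rewrite (exponential_pdfE _ (ltW x0')) !mul1r mulN1r.
by rewrite mul0r lt0_exponential_pdf// lt_neqAle x0.
Qed.

End gamma_function.

(** * Normalised power kernels and their convolution *)

Section fractional_kernel.
Context {R : realType}.
Local Notation mu := (@lebesgue_measure R).
Implicit Types (m n u v w : R).

Definition frac_kernel n u : R := (Gamma n)^-1 * pow_kernel n u.

Lemma frac_kernel_ge0 n u : 0 < n -> 0 <= frac_kernel n u.
Proof.
move=> n0; apply: mulr_ge0; last exact: pow_kernel_ge0.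
by rewrite invr_ge0 ltW// Gamma_gt0.
Qed.

Lemma frac_kernel_le0 n u : u <= 0 -> frac_kernel n u = 0.
Proof. by move=> u0; rewrite /frac_kernel /pow_kernel ltNge u0 mulr0. Qed.

Lemma frac_kernel1 u : 0 < u -> frac_kernel 1 u = 1.
Proof.
by move=> u0; rewrite /frac_kernel /pow_kernel u0 Gamma1 invr1 mul1r subrr powRr0.
Qed.

Lemma measurable_frac_kernel n : measurable_fun setT (frac_kernel n).
Proof. by apply: measurable_funM => //; exact: measurable_pow_kernel. Qed.

Lemma frac_kernelM n w u : 0 < w ->
  frac_kernel n (w * u) = w `^ (n - 1) * frac_kernel n u.
Proof.
move=> w0; rewrite /frac_kernel /pow_kernel pmulr_rgt0//.
case: ltP => u0; last by rewrite !mulr0.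
by rewrite powRM ?(ltW w0) ?(ltW u0)// mulrCA.
Qed.

(** The Laplace transform of $K_n$ at $1$. *)
Lemma integral_frac_kernel_expR n : 0 < n ->
  (\int[mu]_x (frac_kernel n x * expR (- x))%:E = 1)%E.
Proof.
move=> n0; have G0 := Gamma_gt0 n0.
under eq_integral do rewrite /frac_kernel -mulrA EFinM.
rewrite ge0_integralZl_EFin//.
- by rewrite EFin_Gamma// -EFinM mulVf// gt_eqF.
- by move=> x _; rewrite lee_fin mulr_ge0 ?pow_kernel_ge0 ?expR_ge0.
- apply/measurable_EFinP; apply: measurable_funM; first exact: measurable_pow_kernel.
  by apply: measurableT_comp => //; exact: measurable_expR.
- by rewrite invr_ge0 ltW.
Qed.

(** Substituting $v = w v'$ extracts $w \cdot w^{m-1} w^{n-1} = w^{m+n-1}$ by homogeneity. The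
    remaining integral is $B(m,n)/(\Gamma(m)\Gamma(n))$, left as an extended real because its
    finiteness is not yet known. For $w \le 0$ the two kernels have disjoint supports. *)
Lemma frac_kernel_conv_pow m n w : 0 < m -> 0 < n ->
  (\int[mu]_v (frac_kernel m (w - v) * frac_kernel n v)%:E =
   \int[mu]_v (frac_kernel m (1 - v) * frac_kernel n v)%:E
     * (pow_kernel (m + n) w)%:E)%E.
Proof.
move=> m0 n0.
have mK z : measurable_fun setT
    (fun v : R => (frac_kernel m (z - v) * frac_kernel n v)%:E).
  apply/measurable_EFinP; apply: measurable_funM; last exact: measurable_frac_kernel.
  apply: (measurableT_comp (@measurable_frac_kernel m)).
  exact: measurable_funB.
have K0 z v : (0 <= (frac_kernel m (z - v) * frac_kernel n v)%:E)%E.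
  by rewrite lee_fin mulr_ge0 ?frac_kernel_ge0.
have [w0|w0] := ltP 0 w; last first.
  rewrite [X in (_ * X)%E](_ : _ = 0%E); last by rewrite /pow_kernel ltNge w0.
  rewrite mule0; apply: integral0_eq => v _.
  have [v0|v0] := leP v 0; first by rewrite (frac_kernel_le0 n v0) mulr0.
  by rewrite frac_kernel_le0 ?mul0r//; lra.
rewrite (@ge0_integral_affine R w 0) ?gt_eqF//.
under eq_integral do rewrite addr0 -[X in X - _]mulr1 -mulrBr !frac_kernelM//
  mulrACA EFinM.
rewrite ge0_integralZl_EFin//;
  [|exact: mK|by rewrite mulr_ge0 ?powR_ge0].
rewrite muleA muleC; congr (_ * _)%E.
rewrite -EFinM /pow_kernel w0 gtr0_norm// mulrA mulr_powRB1 ?(ltW w0)//.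
by rewrite -powRD ?addrA// (gt_eqF w0) implybT.
Qed.

(* Integrating [K_m * K_n] against [exp(-w)] gives [1] on both sides, which
   identifies the constant [B(m,n)/(Gamma m Gamma n)] without computing it. *)
Lemma frac_kernel_conv m n w : 0 < m -> 0 < n ->
  (\int[mu]_v (frac_kernel m (w - v) * frac_kernel n v)%:E =
   (frac_kernel (m + n) w)%:E)%E.
Proof.
move=> m0 n0; have mn0 : 0 < m + n by exact: addr_gt0.
rewrite frac_kernel_conv_pow//.
set c := (\int[mu]_v (frac_kernel m (1 - v) * frac_kernel n v)%:E)%E.
have c0 : (0 <= c)%E.
  by apply: integral_ge0 => v _; rewrite lee_fin mulr_ge0 ?frac_kernel_ge0.
have G0 := Gamma_gt0 mn0.
have mexp : measurable_fun setT (fun x : R => expR (- x)).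
  by apply: measurableT_comp => //; exact: measurable_expR.
suff cG : (c * (Gamma (m + n))%:E = 1)%E.
  (* An infinite [c] times a positive Gamma value could not be $1$, so finiteness comes from the
     same identity. *)
  have cfin : c \is a fin_num.
    rewrite ge0_fin_numE// ltey; apply/eqP => cy; move: cG.
    by rewrite cy gt0_mulye ?lte_fin.
  rewrite /frac_kernel EFinM; congr (_ * _)%E.
  rewrite -(fineK cfin); congr EFin.
  have : fine c * Gamma (m + n) = 1.
    by apply: EFin_inj; rewrite EFinM fineK.
  move=> h; apply: (mulIf (lt0r_neq0 G0)); rewrite h mulVf// gt_eqF//.
rewrite -EFin_Gamma// -ge0_integralZl//; last 2 first.
- apply/measurable_EFinP; apply: measurable_funM => //.
  exact: measurable_pow_kernel.
- by move=> x _; rewrite lee_fin mulr_ge0 ?pow_kernel_ge0 ?expR_ge0.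
pose f (p : measurableTypeR R * measurableTypeR R) : \bar R :=
  (frac_kernel m (p.1 - p.2) * frac_kernel n p.2 * expR (- p.1))%:E.
have mf : measurable_fun setT f.
  apply/measurable_EFinP; apply: measurable_funM; last first.
    exact: (measurableT_comp mexp).
  apply: measurable_funM.
    apply: (measurableT_comp (@measurable_frac_kernel m)).
    exact: measurable_funB.
  exact: (measurableT_comp (@measurable_frac_kernel n)).
have f0 p : (0 <= f p)%E.
  rewrite lee_fin; apply: mulr_ge0; last exact: expR_ge0.
  by apply: mulr_ge0; exact: frac_kernel_ge0.
transitivity (\int[mu]_x \int[mu]_y f (x, y))%E.
  apply: eq_integral => x _; rewrite EFinM muleA -frac_kernel_conv_pow//.
  rewrite /f; under [RHS]eq_integral do rewrite /= EFinM.
  rewrite ge0_integralZr//.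
  - apply/measurable_EFinP; apply: measurable_funM; last exact: measurable_frac_kernel.
    apply: (measurableT_comp (@measurable_frac_kernel m)).
    exact: measurable_funB.
  - by move=> v _; rewrite lee_fin mulr_ge0 ?frac_kernel_ge0.
rewrite (fubini_tonelli f)// -(integral_frac_kernel_expR n0).
apply: eq_integral => y _; rewrite /f/=.
(* After the shift $e^{-(x+y)}$ factors, and the inner integral becomes the Laplace transform of
   $K_m$, which is $1$. *)
rewrite (@ge0_integral_shift R y); last 2 first.
- apply/measurable_EFinP; apply: measurable_funM => //.
  apply: measurable_funM => //.
  apply: (measurableT_comp (@measurable_frac_kernel m)).
  exact: measurable_funB.
- move=> x; rewrite lee_fin; apply: mulr_ge0; last exact: expR_ge0.
  by apply: mulr_ge0; exact: frac_kernel_ge0.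
under eq_integral => x _.
  rewrite addrK opprD expRD (_ : _ * _ = frac_kernel n y * expR (- y) *
    (frac_kernel m x * expR (- x))); last by ring.
  rewrite EFinM; over.
rewrite ge0_integralZl_EFin//.
- by rewrite integral_frac_kernel_expR// mule1.
- by move=> x _; rewrite lee_fin mulr_ge0 ?frac_kernel_ge0 ?expR_ge0.
- apply/measurable_EFinP; apply: measurable_funM => //.
  exact: measurable_frac_kernel.
- by rewrite mulr_ge0 ?frac_kernel_ge0 ?expR_ge0.
Qed.

End fractional_kernel.

(** * Classical fractional integrals *)

Section fractional_convolution.
Context {R : realType}.
Local Notation mu := (@lebesgue_measure R).
Implicit Types (m n u v w x a b c : R) (f g h : R -> R).

(* Holds without integrability: scaling by [c > 0] also preserves the infinite
   integrals, which [fine] sends to [0]. *)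
Lemma RintegralZl_gt0 c f : 0 < c -> measurable_fun setT f ->
  \int[mu]_x (c * f x) = c * \int[mu]_x f x.
Proof.
move=> c0 mf; rewrite /Rintegral.
have mEf : measurable_fun setT (EFin \o f) by exact/measurable_EFinP.
have -> : (\int[mu]_x (c * f x)%:E = c%:E * \int[mu]_x (f x)%:E)%E.
  under eq_integral do rewrite EFinM.
  rewrite integralE [in RHS]integralE.
  rewrite ge0_funeposM ?ge0_funenegM ?(ltW c0)//.
  rewrite !ge0_integralZl_EFin ?(ltW c0)//;
    [|exact: measurable_funeneg|exact: measurable_funepos].
  case: (integral _ _ _^\+)%E => [A| |]; case: (integral _ _ _^\-)%E => [B| |] //=;
    rewrite ?gt0_muley ?gt0_muleNy ?gt0_mulye ?gt0_mulNye ?lte_fin//=.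
  by rewrite -!EFinM -!EFinB mulrBr.
by case: (integral _ _ _)%E => [A| |];
  rewrite ?gt0_muley ?gt0_muleNy ?lte_fin//= mulr0.
Qed.

Lemma measurable_frac_kernel_subl n x h : measurable_fun setT h ->
  measurable_fun setT (fun t : R => frac_kernel n (x - t) * h t).
Proof.
move=> mh; apply: measurable_funM => //.
apply: (measurableT_comp (@measurable_frac_kernel R n)).
exact: measurable_funB.
Qed.

(** For [h] extended by zero outside $[a,b]$, the support of [h] supplies the lower limit $a$ and
    the cut-off of the kernel the upper limit $x$, so the integral is a convolution on the line. *)
Definition frac_conv n h x : R := \int[mu]_t (frac_kernel n (x - t) * h t).

Let prodfun n h (p : measurableTypeR R * measurableTypeR R) : \bar R :=
  (frac_kernel n (p.1 - p.2) * h p.2)%:E.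

Let measurable_prodfun n h : measurable_fun setT h ->
  measurable_fun setT (prodfun n h).
Proof.
move=> mh; apply/measurable_EFinP; apply: measurable_funM.
  apply: (measurableT_comp (@measurable_frac_kernel R n)).
  exact: measurable_funB.
exact: (measurableT_comp mh).
Qed.

(** Tonelli applied separately to the positive and negative parts, so that no integrability is
    involved. *)
Lemma measurable_frac_conv n h : measurable_fun setT h ->
  measurable_fun setT (frac_conv n h).
Proof.
move=> mh; apply: measurableT_comp => //.
have -> : (fun x => \int[mu]_t (frac_kernel n (x - t) * h t)%:E)%E =
    (fun x => \int[mu]_t ((prodfun n h)^\+ (x, t)) -
              \int[mu]_t ((prodfun n h)^\- (x, t)))%E.
  apply/funext => x; rewrite integralE; congr (_ - _)%E.
    by apply: eq_integral => t _; rewrite !funeposE.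
  by apply: eq_integral => t _; rewrite !funenegE.
apply: emeasurable_funB.
- apply: (measurable_fun_fubini_tonelli_F ((prodfun n h)^\+)%E) => //.
  by apply: measurable_funepos; exact: measurable_prodfun.
- apply: (measurable_fun_fubini_tonelli_F ((prodfun n h)^\-)%E) => //.
  by apply: measurable_funeneg; exact: measurable_prodfun.
Qed.

Lemma frac_kernel_conv_sub m n x t : 0 < m -> 0 < n ->
  (\int[mu]_s (frac_kernel m (x - s) * frac_kernel n (s - t))%:E =
   (frac_kernel (m + n) (x - t))%:E)%E.
Proof.
move=> m0 n0; rewrite (@ge0_integral_shift R t).
- rewrite -(frac_kernel_conv (x - t) m0 n0); apply: eq_integral => s _.
  by rewrite addrK opprD addrCA addrC addrAC.
- apply/measurable_EFinP; apply: measurable_frac_kernel_subl.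
  apply: (measurableT_comp (@measurable_frac_kernel R n)).
  exact: measurable_funB.
- by move=> s; rewrite lee_fin mulr_ge0 ?frac_kernel_ge0.
Qed.

(** Integrating $K_m(x-s) K_n(s-t) |h(t)|$ in $s$ first leaves $K_{m+n}(x-t)|h(t)|$, so the
    hypothesis is exactly integrability on the product and Fubini applies. The first conclusion is
    kept because it yields integrability of fractional integrals of $L^1$ functions. *)
Lemma frac_conv_frac_conv m n h x : 0 < m -> 0 < n -> measurable_fun setT h ->
  mu.-integrable setT (fun t => (frac_kernel (m + n) (x - t) * h t)%:E) ->
  mu.-integrable setT (fun s => (frac_kernel m (x - s) * frac_conv n h s)%:E) /\
  frac_conv m (frac_conv n h) x = frac_conv (m + n) h x.
Proof.
move=> m0 n0 mh ih.
pose f (p : measurableTypeR R * measurableTypeR R) : \bar R :=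
  (frac_kernel m (x - p.1) * (frac_kernel n (p.1 - p.2) * h p.2))%:E.
have mf : measurable_fun setT f.
  apply/measurable_EFinP; apply: measurable_funM.
    apply: (measurableT_comp (@measurable_frac_kernel R m)).
    exact: measurable_funB.
  by apply/measurable_EFinP; exact: measurable_prodfun.
have intf t : (\int[mu]_s `|f (s, t)| =
    `|(frac_kernel (m + n) (x - t) * h t)%:E|)%E.
  rewrite /f/=.
  under eq_integral do rewrite mulrA normrM EFinM.
  rewrite ge0_integralZr//.
  - rewrite normrM EFinM; congr (_ * _)%E.
    rewrite ger0_norm ?frac_kernel_ge0 ?addr_gt0// -(frac_kernel_conv_sub x t m0 n0).
    apply: eq_integral => s _; rewrite ger0_norm//.
    by rewrite mulr_ge0 ?frac_kernel_ge0.
  - apply/measurable_EFinP; apply: measurableT_comp => //.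
    apply: measurable_frac_kernel_subl.
    apply: (measurableT_comp (@measurable_frac_kernel R n)).
    exact: measurable_funB.
have intf' t : (\int[mu]_s f (s, t) = (frac_kernel (m + n) (x - t) * h t)%:E)%E.
  rewrite /f/=.
  under eq_integral do rewrite mulrA EFinM.
  rewrite EFinM -(frac_kernel_conv_sub x t m0 n0) integralZr//.
  apply/integrableP; split.
    apply/measurable_EFinP; apply: measurable_frac_kernel_subl.
    apply: (measurableT_comp (@measurable_frac_kernel R n)).
    exact: measurable_funB.
  under eq_integral => s _.
    rewrite gee0_abs ?lee_fin; last by rewrite mulr_ge0 ?frac_kernel_ge0.
    over.
  by rewrite frac_kernel_conv_sub// ltry.
have iF : (mu \x mu)%E.-integrable setT f.
  apply/(integrable21ltyP _ _ mf).
  under eq_integral do rewrite intf.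
  by case/integrableP: ih.
have mconv : measurable_fun setT
    (fun s : R => (frac_kernel m (x - s) * frac_conv n h s)%:E).
  apply/measurable_EFinP; apply: measurable_frac_kernel_subl.
  exact: measurable_frac_conv.
have mF := measurable_fubini_F iF.
(* [frac_conv] passes through [fine], so it agrees with the inner Fubini integral only where that
   integral converges. Fubini gives this for almost every $s$ with $K_m(x-s) \ne 0$; where the
   factor vanishes both sides are $0$. *)
have aeF : ae_eq mu setT (fun s => (frac_kernel m (x - s) * frac_conv n h s)%:E)
    (fubini_F mu f).
  rewrite /frac_conv /fubini_F /Rintegral.
  have := ae_integrable1 iF; apply: filterS => s /= is_ _.
  rewrite /f/=.
  have [xs|xs] := leP (x - s) 0.
    rewrite frac_kernel_le0// mul0r; under eq_integral do rewrite mul0r.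
    by rewrite integral0.
  have k0 : frac_kernel m (x - s) != 0.
    by rewrite gt_eqF// mulr_gt0 ?invr_gt0 ?Gamma_gt0// /pow_kernel xs powR_gt0.
  have i2 : mu.-integrable setT (fun t => (frac_kernel n (s - t) * h t)%:E).
    have := @integrableZl _ _ _ mu _ measurableT (frac_kernel m (x - s))^-1 _ is_.
    apply: eq_integrable => // t _; rewrite /f/= -EFinM; congr EFin.
    exact: mulKf.
  under [RHS]eq_integral do rewrite EFinM.
  by rewrite integralZl// EFinM fineK//; exact: integrable_fin_num.
split.
  apply/integrableP; split => //.
  have /integrableP[_] := integrable_fubini_F iF.
  congr (_ < _)%E; apply: ge0_ae_eq_integral => //.
  - exact: measurableT_comp.
  - exact: measurableT_comp.
  - by apply: filterS aeF => s E sT; congr abse; exact: esym (E sT).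
rewrite {1}/frac_conv /Rintegral; congr fine.
transitivity (\int[mu]_s \int[mu]_t f (s, t))%E; last first.
  by rewrite (Fubini iF); apply: eq_integral => t _; rewrite intf'.
exact: ae_eq_integral.
Qed.

(** The factor $K_1$ truncates the kernel to $t > c$, and the convolution identity evaluates the
    integral as $K_{n+1}(x-c)$. *)
Lemma integrable_frac_kernel n x c : 0 < n ->
  mu.-integrable setT (fun t => (frac_kernel n (x - t) * frac_kernel 1 (t - c))%:E).
Proof.
move=> n0; apply/integrableP; split.
  apply/measurable_EFinP; apply: measurable_frac_kernel_subl.
  apply: (measurableT_comp (@measurable_frac_kernel R 1)).
  exact: measurable_funB.
under eq_integral => s _.
  rewrite gee0_abs ?lee_fin; last by rewrite mulr_ge0 ?frac_kernel_ge0.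
  over.
by rewrite frac_kernel_conv_sub// ltry.
Qed.

(** Dominated by $M K_n(x-t) K_1(t-(a-1))$; the base point $a-1$ rather than $a$ makes the last
    factor $1$ at $t = a$ too. *)
Lemma integrable_frac_kernel_bounded n x a b M g : 0 < n ->
  measurable_fun `[a, b] g -> (forall t, t \in `[a, b] -> `|g t| <= M) ->
  mu.-integrable setT (fun t => (frac_kernel n (x - t) * (g \_ `[a, b]) t)%:E).
Proof.
move=> n0 mg gM.
have := @integrableZl _ _ _ mu _ measurableT M _
  (@integrable_frac_kernel n x (a - 1) n0).
apply: le_integrable => //.
  apply/measurable_EFinP; apply: measurable_frac_kernel_subl.
  exact/(measurable_restrictT _ _).1.
move=> t _; rewrite /= lee_fin !patchE mem_setE.
case: ifPn => [tab|_]; last by rewrite mulr0 normr0 normr_ge0.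
rewrite (@frac_kernel1 _ (t - (a - 1))); last first.
  by move: tab; rewrite in_itv/= => /andP[? ?]; lra.
have := frac_kernel_ge0 (x - t) n0; move: (frac_kernel n (x - t)) => k k0.
rewrite mulr1 !normrM mulrC ler_wpM2r//.
by rewrite (le_trans (gM _ tab))// ler_norm.
Qed.

Lemma frac_kernel_le n u c : 1 <= n -> u <= c -> 0 < c ->
  frac_kernel n u <= frac_kernel n c.
Proof.
move=> n1 uc c0; have n0 : 0 < n by exact: lt_le_trans n1.
apply: ler_wpM2l; first by rewrite invr_ge0 ltW ?Gamma_gt0.
rewrite /pow_kernel c0.
case: ltP => u0; last exact: powR_ge0.
by apply: ge0_ler_powR; rewrite ?nnegrE ?subr_ge0// ltW.
Qed.

(** From order one on the kernel is nondecreasing, hence bounded by $K_n(b-a)$ for $a \le t$ and $x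
    \le b$. *)
Lemma integrable_frac_kernel_L1 n x a b g : a < b -> 1 <= n -> x <= b ->
  mu.-integrable `[a, b] (EFin \o g) ->
  mu.-integrable setT (fun t => (frac_kernel n (x - t) * (g \_ `[a, b]) t)%:E).
Proof.
move=> ab n1 xb ig; have n0 : 0 < n by exact: lt_le_trans n1.
have ig' : mu.-integrable setT (EFin \o (g \_ `[a, b])).
  by rewrite -restrict_EFin; apply/integrable_restrict => //; rewrite setTI.
have := @integrableZl _ _ _ mu _ measurableT (frac_kernel n (b - a)) _ ig'.
apply: le_integrable => //.
  apply/measurable_EFinP; apply: measurable_frac_kernel_subl.
  by apply/measurable_EFinP; case/integrableP: ig'.
move=> t _; rewrite /= lee_fin !patchE mem_setE.
case: ifPn => [tab|_]; last by rewrite !mulr0.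
have k0 := frac_kernel_ge0 (x - t) n0.
have k1 : frac_kernel n (x - t) <= frac_kernel n (b - a).
  apply: frac_kernel_le => //; last by lra.
  by move: tab; rewrite in_itv/= => /andP[? ?]; lra.
move: (frac_kernel n (x - t)) (frac_kernel n (b - a)) k0 k1 => k k' k0 k1.
by rewrite !normrM ler_wpM2r// !ger0_norm// (le_trans k0).
Qed.

End fractional_convolution.

(** * Composition and sup-norm bounds of fractional integrals on a segment *)

Section classical_fractional_integral.
Context {R : realType}.
Variables (a b : R).
Hypothesis ab : a < b.
Local Notation mu := (@lebesgue_measure R).
Implicit Types (m n x : R) (f g : R -> R).

(** The integrands can differ at $t = x$, where the cut-off kernel is $0$ but $0^{n-1}$ is $1$ for
    $n = 1$; that point is negligible. The factor $1/\Gamma(n)$ is moved by [RintegralZl_gt0], as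
    the integral may diverge. *)
Lemma RLclE n g x : 0 < n -> x \in `[a, b] -> measurable_fun `[a, b] g ->
  RLcl a n g x = frac_conv n (g \_ `[a, b]) x.
Proof.
move=> n0 /[dup] xab; rewrite in_itv/= => /andP[ax xb] mg.
have mgr : measurable_fun setT (g \_ `[a, b]) by exact/(measurable_restrictT _ _).1.
rewrite /RLcl gt_eqF// /frac_conv.
transitivity ((Gamma n)^-1 *
    \int[mu]_t (pow_kernel n (x - t) * (g \_ `[a, b]) t)); last first.
  rewrite -RintegralZl_gt0 ?invr_gt0 ?Gamma_gt0//.
    by apply: eq_Rintegral => t _; rewrite mulrA.
  apply: measurable_funM => //.
  apply: (measurableT_comp (@measurable_pow_kernel R n)).
  exact: measurable_funB.
congr (_ * _); rewrite /Rintegral; congr fine.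
have mf : measurable_fun `[a, x] (fun t => ((x - t) `^ (n - 1) * g t)%:E).
  apply/measurable_EFinP; apply: measurable_funM.
    apply: measurable_funTS; apply: (measurableT_comp (@measurable_powR R (n - 1))).
    exact: measurable_funB.
  by apply: measurable_funS mg => // t /=; rewrite !in_itv/= => /andP[-> /le_trans ->].
rewrite -integral_itv_bndo_bndc; last first.
  apply: measurable_funS mf => // t /=.
  by rewrite !in_itv/= => /andP[-> /ltW ->].
rewrite [LHS]integral_mkcond; apply: eq_integral => t _.
rewrite !patchE !mem_setE !in_itv/= /pow_kernel subr_gt0.
have [ta|ta] := leP a t => /=; last by rewrite mulr0.
have [tx|tx] := ltP t x; last by rewrite mul0r.
by rewrite (le_trans (ltW tx) xb).
Qed.

Lemma frac_conv_restrict_le n g x : x <= a ->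
  frac_conv n (g \_ `[a, b]) x = 0.
Proof.
move=> xa; rewrite /frac_conv.
transitivity (\int[mu]_t (0 : R)); last by rewrite Rintegral_cst// mul0r.
apply: eq_Rintegral => t _; rewrite patchE mem_setE in_itv/=.
case: ifPn => [/andP[ta _]|_]; last by rewrite mulr0.
by rewrite frac_kernel_le0 ?mul0r//; lra.
Qed.

Lemma measurable_RLcl n g : 0 <= n -> measurable_fun `[a, b] g ->
  measurable_fun `[a, b] (RLcl a n g).
Proof.
rewrite le_eqVlt => /predU1P[<- mg|n0 mg].
  by apply: (eq_measurable_fun g) mg => x _; rewrite /RLcl eqxx.
apply: (eq_measurable_fun (frac_conv n (g \_ `[a, b]))).
  by move=> x; rewrite inE/= => xab; rewrite RLclE.
apply: measurable_funTS; apply: measurable_frac_conv.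
exact/(measurable_restrictT _ _).1.
Qed.

(** The outer integral sees the inner one only on $[a,b]$, and nothing is lost: to the left of $a$
    the inner convolution vanishes, and to the right of $b \ge x$ the outer kernel does. *)
Lemma RLcl_RLcl m n g x : 0 < m -> 0 < n -> x \in `[a, b] ->
  measurable_fun `[a, b] g ->
  mu.-integrable setT
    (fun t => (frac_kernel (m + n) (x - t) * (g \_ `[a, b]) t)%:E) ->
  RLcl a m (RLcl a n g) x = RLcl a (m + n) g x.
Proof.
move=> m0 n0 xab mg ig.
have mgr : measurable_fun setT (g \_ `[a, b]) by exact/(measurable_restrictT _ _).1.
rewrite !RLclE ?addr_gt0//; last by apply: measurable_RLcl => //; exact: ltW.
have [_ <-] := frac_conv_frac_conv m0 n0 mgr ig; apply: eq_Rintegral => s _.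
rewrite patchE mem_setE; case: ifPn => sab; first by rewrite RLclE.
have [sa|sa] := leP s a; first by rewrite frac_conv_restrict_le.
rewrite frac_kernel_le0 ?mul0r//.
by move: xab sab; rewrite !in_itv/= (ltW sa)/= -ltNge => /andP[_]; lra.
Qed.

Lemma RLcl_RLcl_bounded m n g x M : 0 < m -> 0 < n -> x \in `[a, b] ->
  measurable_fun `[a, b] g -> (forall t, t \in `[a, b] -> `|g t| <= M) ->
  RLcl a m (RLcl a n g) x = RLcl a (m + n) g x.
Proof.
move=> m0 n0 xab mg gM; apply: RLcl_RLcl => //.
by apply: integrable_frac_kernel_bounded gM => //; exact: addr_gt0.
Qed.

(** The condition [1 <= m + n] bounds the composed kernel, which gives Fubini at every point and not
    merely almost everywhere. *)
Lemma RLcl_RLcl_L1 m n g x : 0 < m -> 0 < n -> 1 <= m + n -> x \in `[a, b] ->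
  L1 a b g -> RLcl a m (RLcl a n g) x = RLcl a (m + n) g x.
Proof.
move=> m0 n0 mn xab ig; apply: RLcl_RLcl => //.
  by case/integrableP: ig => /measurable_EFinP.
by apply: integrable_frac_kernel_L1 => //; move: xab; rewrite in_itv/= => /andP[].
Qed.

(** Compose with $J^1$ at the point $b + 1$: there $K_1(b+1-s) = 1$ for all $s \in [a,b]$, so the
    integrability supplied by [frac_conv_frac_conv] is that of $J^n g$ itself. *)
Lemma L1_RLcl n g : 0 < n -> L1 a b g -> L1 a b (RLcl a n g).
Proof.
move=> n0 ig.
have mg : measurable_fun `[a, b] g by case/integrableP: ig => /measurable_EFinP.
have mgr : measurable_fun setT (g \_ `[a, b]) by exact/(measurable_restrictT _ _).1.
have n1 : 1 <= 1 + n by rewrite lerDl ltW.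
have ab1 : a < b + 1 by move: ab; lra.
have ig1 : mu.-integrable setT
    (fun t => (frac_kernel (1 + n) (b + 1 - t) * (g \_ `[a, b]) t)%:E).
  have -> : g \_ `[a, b] = (g \_ `[a, b]) \_ `[a, b + 1].
    apply/funext => t; rewrite !patchE !mem_setE !in_itv/=.
    case: ifPn => [/andP[ta tb]|_]; last by rewrite if_same.
    by rewrite ta (le_trans tb)// lerDl.
  apply: integrable_frac_kernel_L1 => //.
  have ig' : mu.-integrable setT (EFin \o (g \_ `[a, b])).
    by rewrite -restrict_EFin; apply/integrable_restrict => //; rewrite setTI.
  by apply: integrableS ig'.
have [i1 _] := frac_conv_frac_conv ltr01 n0 mgr ig1.
have : mu.-integrable `[a, b]
    (fun s => (frac_kernel 1 (b + 1 - s) * frac_conv n (g \_ `[a, b]) s)%:E).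
  by apply: integrableS i1.
apply: eq_integrable => // s; rewrite inE/= => sab.
rewrite frac_kernel1 ?mul1r ?RLclE//.
by move: sab; rewrite in_itv/= => /andP[_]; lra.
Qed.

Lemma RLcl1 g x : RLcl a 1 g x = \int[mu]_(t in `[a, x]) g t.
Proof.
rewrite /RLcl oner_eq0 Gamma1 invr1 mul1r; apply: eq_Rintegral => t _.
by rewrite subrr powRr0 mul1r.
Qed.

(** The difference is at most $M \int K_n(x-t) K_1(t-(a-1))\,dt = M K_{n+1}(x-a+1)$, and $K_{n+1}$
    is nondecreasing; the $+1$ in the constant comes from the base point $a-1$. *)
Lemma RLcl_dist n f g x M : 0 < n -> x \in `[a, b] ->
  measurable_fun `[a, b] f -> measurable_fun `[a, b] g ->
  (exists A, forall t, t \in `[a, b] -> `|f t| <= A) ->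
  (exists A, forall t, t \in `[a, b] -> `|g t| <= A) ->
  (forall t, t \in `[a, b] -> `|f t - g t| <= M) ->
  `|RLcl a n f x - RLcl a n g x| <= M * frac_kernel (n + 1) (b - a + 1).
Proof.
move=> n0 xab mf mg [A fA] [B gB] fgM.
have M0 : 0 <= M by apply: le_trans (fgM a _) => //; rewrite in_itv/= lexx ltW.
have fi := integrable_frac_kernel_bounded x n0 mf fA.
have gi := integrable_frac_kernel_bounded x n0 mg gB.
rewrite !RLclE// /frac_conv -RintegralB//.
have ki := @integrable_frac_kernel R n x (a - 1) n0.
have Mki := @integrableZl _ _ _ mu _ measurableT M _ ki.
have fgi := integrableB measurableT fi gi.
apply: (le_trans (le_normr_Rintegral _ _)) => //.
have Mk : \int[mu]_t (M * (frac_kernel n (x - t) * frac_kernel 1 (t - (a - 1)))) =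
    M * frac_kernel (n + 1) (x - (a - 1)).
  by rewrite RintegralZl// /Rintegral frac_kernel_conv_sub.
apply: (@le_trans _ _ (M * frac_kernel (n + 1) (x - (a - 1)))); last first.
  apply: ler_wpM2l => //; move: xab; rewrite in_itv/= => /andP[ax xb].
  by apply: frac_kernel_le; lra.
rewrite -Mk; apply: le_Rintegral => //.
  have := integrable_norm fgi; apply: eq_integrable => //.
move=> t _; rewrite -mulrBr normrM ger0_norm ?frac_kernel_ge0//.
rewrite !patchE mem_setE; case: ifPn => [tab|_]; last first.
  rewrite subrr normr0 mulr0; apply: mulr_ge0 => //.
  by apply: mulr_ge0; exact: frac_kernel_ge0.
rewrite (@frac_kernel1 _ (t - (a - 1))); last first.
  by move: tab; rewrite in_itv/= => /andP[? ?]; lra.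
by rewrite mulr1 mulrC ler_wpM2r ?fgM ?frac_kernel_ge0.
Qed.

End classical_fractional_integral.

(** * Density of indefinite integrals, and continuity of fractional integrals *)

Section density_and_continuity.
Context {R : realType}.
Local Notation mu := (@lebesgue_measure R).
Implicit Types (c d e n x y : R) (f g F G : R -> R).

Lemma within_continuous_uniform_limit (A : set R) f :
  (forall e, 0 < e -> exists2 g, {within A, continuous g} &
     forall x, A x -> `|g x - f x| <= e) -> {within A, continuous f}.
Proof.
move=> H; apply/subspace_continuousP => x Ax; apply/cvgrPdist_le => e e0.
have e3 : 0 < e / 3 by rewrite divr_gt0.
have [g /subspace_continuousP /(_ x Ax) /cvgrPdist_le /(_ _ e3) cg gf] := H _ e3.
rewrite near_withinE in cg; rewrite near_withinE.
apply: filterS cg => y Hy Ay.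
have gxy : `|g x - g y| <= e / 3 := Hy Ay.
suff : `|f x - f y| <= e by [].
move: (gf _ Ax) (gf _ Ay) gxy; rewrite !ler_norml => /andP[? ?] /andP[? ?] /andP[? ?].
by apply/andP; split; lra.
Qed.

(** Only [x] is confined to the segment: the averages below look slightly to the left of $a$. *)
Lemma segment_uniform_continuous G c d e : continuous G -> 0 < e ->
  exists2 r, 0 < r & forall x y, x \in `[c, d] -> `|x - y| <= r ->
    `|G x - G y| <= e.
Proof.
move=> cG e0; have e2 : 0 < e / 2 by rewrite divr_gt0.
have /compact_near_coveringP cov := @segment_compact R c d.
have := cov R 0^'+ (fun r x => forall y, `|x - y| <= r -> `|G x - G y| <= e) _.
case.
  move=> x _; have /cvgrPdist_le /(_ _ e2) /nbhs_ballP[r /= r0 Hr] := cG x.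
  exists (ball x (r / 2), [set s | s < r / 2]) => /=.
    split; first by apply: nbhsx_ballx; rewrite divr_gt0.
    by apply: nbhs_right_lt; rewrite divr_gt0.
  move=> [x' s] /= [xx' sr] y x'y.
  have h1 := Hr x'; have h2 := Hr y; rewrite /ball/= in xx' h1 h2.
  have {}h1 : `|G x - G x'| <= e / 2 by apply: h1; apply: (lt_trans xx'); lra.
  have {}h2 : `|G x - G y| <= e / 2.
    apply: h2; have := ler_normD (x - x') (x' - y); rewrite addrA subrK.
    by move/le_lt_trans; apply; lra.
  move: h1 h2; rewrite !ler_norml => /andP[? ?] /andP[? ?].
  by apply/andP; split; lra.
move=> r /= r0 Hr; exists (r / 2); first by rewrite divr_gt0.
move=> x y xcd xy; apply: (Hr (r / 2)) => //=; last by rewrite divr_gt0.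
by rewrite sub0r normrN gtr0_norm ?divr_gt0//; lra.
Qed.

Variables (a b : R).
Hypothesis ab : a < b.

(** The retraction of the line onto $[a,b]$; composing with it extends a continuous function by its
    end values. *)
Let clamp x : R := Num.max a (Num.min x b).

Let clamp_itv x : clamp x \in `[a, b].
Proof.
rewrite in_itv/= /clamp le_max lexx/= ge_max (ltW ab)/= ge_min lexx orbT//.
Qed.

Let clamp_id x : x \in `[a, b] -> clamp x = x.
Proof.
by rewrite in_itv/= /clamp => /andP[ax xb]; rewrite min_l// max_r.
Qed.

Let clamp_le x : x <= a -> clamp x = a.
Proof. by move=> xa; rewrite /clamp max_l// ge_min xa. Qed.

Let continuous_clamp : continuous clamp.
Proof.
move=> x.
suff : {for x, continuous (cst a \max (id \min cst b))} by [].
apply: continuous_max; first exact: cvg_cst.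
by apply: continuous_min; [exact: cvg_id|exact: cvg_cst].
Qed.

Let continuous_extend F : {within `[a, b], continuous F} ->
  continuous (F \o clamp).
Proof.
move=> /subspace_continuousP cF x.
apply: (@cvg_comp _ _ _ clamp F _ _ _ _ (cF _ (clamp_itv x))).
move=> P /= wP.
have h : nbhs x (fun t => `[a, b]%classic (clamp t) -> P (clamp t)).
  exact: continuous_clamp wP.
by apply: (filterS _ h) => y Py; exact: Py (clamp_itv y).
Qed.

(* Steklov averages [(G x - G (x - s)) / s] of the antiderivative [G] of [F]. *)
Lemma RLcl1_dense F e : in_C0 a b F -> 0 < e ->
  exists2 f, continuous f &
    forall x, x \in `[a, b] -> `|RLcl a 1 f x - F x| <= e.
Proof.
move=> [cF Fa] e0; pose H := F \o clamp.
have cH : continuous H by exact: continuous_extend.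
have [r r0 Hr] := @segment_uniform_continuous H a b e cH e0.
pose s := Num.min r 1; have s0 : 0 < s by rewrite lt_min r0/=.
have sr : s <= r by rewrite ge_min lexx.
have s1 : s <= 1 by rewrite ge_min lexx orbT.
(* Since $s \le 1$, the base point $a - 2$ lies strictly left of $x - s$ for every $x \ge a$, so [G]
   is differentiable at all points used. *)
pose G x := \int[mu]_(t in `[a - 2, x]) H t.
have dG x : a - 2 < x -> is_derive x 1 G (H x).
  move=> ax.
  have [||d1 d2] := @continuous_FTC1_closed R H (a - 2) x (x + 1) _ _ ax (cH x).
  - by rewrite ltrDl.
  - apply: continuous_compact_integrable; first exact: segment_compact.
    exact: continuous_subspaceT.
  by apply: DeriveDef; [exact: d1|rewrite -derive1E; exact: d2].
have cG x : a - 2 < x -> {for x, continuous G}.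
  move=> ax; apply: differentiable_continuous; apply/derivable1_diffP.
  by have [] := dG _ ax.
pose P x := s^-1 * (G x - G (x - s)).
pose f x := s^-1 * (H x - H (x - s)).
(* The average is a value of [H] within distance [s], by the mean value theorem; this gives both the
   uniform error bound and [P a = 0]. *)
have PH x : a <= x -> exists2 c, x - s <= c <= x & P x = H c.
  move=> ax.
  have xs : x - s < x by rewrite ltrBlDr ltrDl.
  have [||c] := @MVT _ G H (x - s) x xs.
  - by move=> y; rewrite in_itv/= => /andP[y1 y2]; apply: dG; lra.
  - apply: continuous_in_subspaceT => y; rewrite inE/= in_itv/= => /andP[y1 y2].
    by apply: cG; lra.
  rewrite in_itv/= => /andP[c1 c2] E; exists c; first by rewrite !ltW.
  by rewrite /P E; field; rewrite gt_eqF.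
have cf : continuous f.
  move=> x; apply: cvgM; first exact: cvg_cst.
  apply: cvgB; first exact: cH.
  apply: (@continuous_comp _ _ _ (fun x => x - s) H); last exact: cH.
  by apply: cvgB; [exact: cvg_id|exact: cvg_cst].
exists f => // x xab.
have /andP[ax xb] : a <= x <= b by move: xab; rewrite in_itv.
(* To the left of $a$ the extension is constantly $F(a) = 0$. This makes [P] the indefinite integral
   of [f] from $a$, without additive constant. *)
have Pa : P a = 0.
  have [c /andP[_ ca] ->] := PH a (lexx a).
  by rewrite /H/= clamp_le.
have -> : RLcl a 1 f x = P x.
  rewrite RLcl1; move: ax; rewrite le_eqVlt => /predU1P[<-|ax].
    by rewrite set_itv1 Rintegral_set1 Pa.
  have dP y : a <= y -> is_derive y 1 P (f y).
    move=> ay; have h1 : is_derive y 1 G (H y) by apply: dG; lra.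
    have h2 : is_derive (y - s) 1 G (H (y - s)) by apply: dG; lra.
    rewrite /P /f.
    have h3 : is_derive y 1 (fun x => G (x - s)) (H (y - s)).
      have h4 : is_derive y 1 (fun x : R => x - s) 1.
        by apply: is_derive_eq; rewrite subr0.
      have := @is_derive1_comp R G (fun x => x - s) y _ _ h2 h4.
      by rewrite mulr1.
    have -> : (fun x => s^-1 * (G x - G (x - s))) =
      s^-1 *: (G - (fun x => G (x - s))) by [].
    exact: is_derive_eq.
  have cP y : a <= y -> {for y, continuous P}.
    move=> ay; apply: differentiable_continuous; apply/derivable1_diffP.
    by have [] := dP _ ay.
  rewrite /Rintegral (@continuous_FTC2 _ f P a x)//.
  - by rewrite Pa sube0.
  - exact: continuous_subspaceT.
  - split.
    + by move=> y; rewrite in_itv/= => /andP[/ltW /dP[]].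
    + by apply: cvg_at_right_filter; exact: cP.
    + by apply: cvg_at_left_filter; apply: cP; exact: ltW.
  - move=> y; rewrite in_itv/= => /andP[/ltW /dP[_ D] _].
    by rewrite derive1E.
have [c /andP[c1 c2] ->] := PH _ ax.
rewrite distrC -{1}(clamp_id xab); apply: Hr => //.
by rewrite ger0_norm ?subr_ge0//; lra.
Qed.

Lemma within_continuous_bounded F : {within `[a, b], continuous F} ->
  exists A, forall t, t \in `[a, b] -> `|F t| <= A.
Proof.
move=> /continuous_extend cF.
have : compact ((F \o clamp) @` `[a, b]).
  apply: continuous_compact; last exact: segment_compact.
  exact: continuous_subspaceT.
move=> /compact_bounded[A [_ HA]]; exists (A + 1) => t tab.
apply: (HA (A + 1)); first by rewrite ltrDl.
by exists t => //=; rewrite clamp_id.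
Qed.

Lemma within_continuous_measurable F : {within `[a, b], continuous F} ->
  measurable_fun `[a, b] F.
Proof. by move=> cF; exact: subspace_continuous_measurable_fun. Qed.

Lemma bounded_RLcl n g : 0 < n -> measurable_fun `[a, b] g ->
  (exists A, forall t, t \in `[a, b] -> `|g t| <= A) ->
  exists A, forall t, t \in `[a, b] -> `|RLcl a n g t| <= A.
Proof.
move=> n0 mg [A gA]; exists (A * frac_kernel (n + 1) (b - a + 1)) => t tab.
have R0 : RLcl a n (cst 0) t = 0.
  rewrite /RLcl gt_eqF// (_ : \int[mu]_(_ in _) _ = 0) ?mulr0//.
  transitivity (\int[mu]_(u in `[a, t]) (0 : R)).
    by apply: eq_Rintegral => u _; rewrite mulr0.
  by rewrite Rintegral_cst// mul0r.
rewrite -[X in `|X|]subr0 -R0; apply: (RLcl_dist ab) => //.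
- by exists A.
- by exists 0 => u _; rewrite normr0.
- by move=> u uab; rewrite subr0; exact: gA.
Qed.

Lemma bounded_integrable g : measurable_fun `[a, b] g ->
  (exists A, forall t, t \in `[a, b] -> `|g t| <= A) -> L1 a b g.
Proof.
move=> mg [A gA]; apply: measurable_bounded_integrable => //.
  exact: (compact_finite_measure (@segment_compact R a b)).
exists A; split; first by rewrite num_real.
by move=> x Ax t tab; apply: (le_trans (gA _ tab)); exact: ltW.
Qed.

(* If [F] is a primitive [J^1 f] then [J^n F = J^1 (J^n f)] is a primitive again;
   such [F] are dense and [J^n] is bounded for the sup norm. *)
Lemma continuous_RLcl n F : 0 <= n -> in_C0 a b F -> in_C0 a b (RLcl a n F).
Proof.
rewrite le_eqVlt => /predU1P[<-|n0] CF.
  rewrite (_ : RLcl a 0 F = F)//.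
  by apply/funext => x; rewrite /RLcl eqxx.
have [cF Fa] := CF; split; last first.
  by rewrite /RLcl gt_eqF// set_itv1 Rintegral_set1 mulr0.
apply: within_continuous_uniform_limit => e e0.
set C := frac_kernel (n + 1) (b - a + 1).
have C0 : 0 < C.
  rewrite /C /frac_kernel mulr_gt0 ?invr_gt0 ?Gamma_gt0 ?addr_gt0//.
  have w0 : 0 < b - a + 1 by rewrite addr_gt0 ?subr_gt0.
  by rewrite /pow_kernel w0; exact: powR_gt0.
have [f cf fF] := RLcl1_dense CF (divr_gt0 e0 C0).
have cf' : {within `[a, b], continuous f} by exact: continuous_subspaceT.
have mf := within_continuous_measurable cf'.
have bf := within_continuous_bounded cf'.
have L1f : L1 a b (RLcl a n f).
  apply: bounded_integrable; last exact: bounded_RLcl.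
  by apply: measurable_RLcl => //; exact: ltW.
have E x : x \in `[a, b] -> RLcl a n (RLcl a 1 f) x = RLcl a 1 (RLcl a n f) x.
  have [A fA] := bf.
  move=> xab; rewrite (RLcl_RLcl_bounded n0 ltr01 xab mf fA).
  by rewrite (RLcl_RLcl_bounded ltr01 n0 xab mf fA) addrC.
exists (RLcl a n (RLcl a 1 f)).
  apply: (@subspace_eq_continuous _ _ _
    (fun x => parameterized_integral mu a x (RLcl a n f))).
    move=> x; rewrite inE/= => xab.
    exact: etrans (esym (RLcl1 a _ x)) (esym (E x xab)).
  by apply: parameterized_integral_continuous => //; exact: ltW.
move=> x /= xab.
have := @RLcl_dist R a b ab n (RLcl a 1 f) F x (e / C) n0 xab.
rewrite divfK ?gt_eqF//; apply => //.
- exact: measurable_RLcl.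
- exact: within_continuous_measurable.
- by apply: bounded_RLcl.
- exact: within_continuous_bounded.
Qed.

End density_and_continuity.

(** * Test functions and uniqueness of primitives *)

Section smooth_functions.
Context {R : realType}.
Implicit Types (f g : R -> R) (k n : nat) (c x : R).

(** Means differentiable $k + 1$ times. Unlike [derive1n], the recursion takes the first derivative
    off, which suits induction through the product and chain rules. *)
Fixpoint times_derivable k f : Prop :=
  (forall x, derivable f x 1) /\
  if k is k'.+1 then times_derivable k' (derive1 f) else True.

Lemma times_derivableW k f : times_derivable k.+1 f -> times_derivable k f.
Proof.
elim: k f => [|k IH] f [df cf]; first exact: conj df I.
exact: conj df (IH _ cf).
Qed.

Lemma times_derivable_derive1n f :
  (forall k, times_derivable k f) -> forall k x, derivable (derive1n k f) x 1.
Proof.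
move=> H k; elim: k f H => [|k IH] f H x; first by have [] := H 0.
by rewrite /derive1n iterSr; apply: IH => j; have [] := H j.+1.
Qed.

Lemma times_derivableP k f f' : (forall x, is_derive x 1 f (f' x)) ->
  (if k is k'.+1 then times_derivable k' f' else True) -> times_derivable k f.
Proof.
move=> df; have -> : f' = derive1 f.
  by apply/funext => x; rewrite derive1E; have [_ ->] := df x.
by case: k => [_|k ?]; split => // x; have [] := df x.
Qed.

Lemma times_derivable_is_derive k f x : times_derivable k f ->
  is_derive x 1 f (derive1 f x).
Proof.
have H : (forall y, derivable f y 1) -> is_derive x 1 f (derive1 f x).
  by move=> df; apply: DeriveDef; [exact: df|rewrite derive1E].
by case: k => [|k] [] /H.
Qed.

Lemma times_derivableD k f g : times_derivable k f -> times_derivable k g ->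
  times_derivable k (fun x => f x + g x).
Proof.
elim: k f g => [|k IH] f g cf cg;
  apply: (times_derivableP (f' := fun x => derive1 f x + derive1 g x)) => [x|].
- exact: (is_deriveD (times_derivable_is_derive x cf) (times_derivable_is_derive x cg)).
- by [].
- exact: (is_deriveD (times_derivable_is_derive x cf) (times_derivable_is_derive x cg)).
- by case: cf cg => _ cf [_ cg]; exact: IH.
Qed.

Lemma times_derivableM k f g : times_derivable k f -> times_derivable k g ->
  times_derivable k (fun x => f x * g x).
Proof.
elim: k f g => [|k IH] f g cf cg;
  apply: (times_derivableP
    (f' := fun x => f x * derive1 g x + g x * derive1 f x)) => [x|].
- exact: (is_deriveM (times_derivable_is_derive x cf) (times_derivable_is_derive x cg)).
- by [].
- exact: (is_deriveM (times_derivable_is_derive x cf) (times_derivable_is_derive x cg)).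
- have [_ cf'] := cf; have [_ cg'] := cg.
  by apply: times_derivableD; apply: IH => //; exact: times_derivableW.
Qed.

Lemma times_derivable_cst k c : times_derivable k (fun=> c).
Proof.
elim: k c => [|k IH] c;
  by apply: (times_derivableP (fun x => is_derive_cst c x (1 : R))).
Qed.

Lemma times_derivable_affine k (s c : R) f : times_derivable k f ->
  times_derivable k (fun x => f (s * x + c)).
Proof.
have daff x : is_derive x 1 (fun x : R => s * x + c) s.
  have := is_deriveD (is_deriveZ s (is_derive_id x (1 : R))) (is_derive_cst c x 1).
  by rewrite addr0 /GRing.scale/= mulr1.
have dcomp j h x : times_derivable j h ->
    is_derive x 1 (fun x => h (s * x + c)) (derive1 h (s * x + c) * s).
  move=> cf; have df := times_derivable_is_derive (s * x + c) cf.
  by have := @is_derive1_comp R h (fun x => s * x + c) x _ _ df (daff x).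
elim: k f => [|k IH] f cf;
  apply: (times_derivableP (fun x => dcomp _ _ x cf)) => //.
have [_ cf'] := cf.
by apply: times_derivableM; [exact: IH|exact: times_derivable_cst].
Qed.

(* The powers [x^-n] make the family stable under derivation, up to linear
   combinations, so that smoothness is an induction on the order. *)
Definition flat n x : R := if 0 < x then x^-1 ^+ n * expR (- x^-1) else 0.

(** From $e^y \ge y^{n+2}/(n+2)!$ at $y = 1/x$. A quadratic bound makes the difference quotient at
    $0$ tend to $0$. *)
Lemma flat_le n x : `|flat n x| <= n.+2`!%:R * x ^+ 2.
Proof.
rewrite /flat; case: ltP => x0; last first.
  by rewrite normr0 mulr_ge0// exprn_even_ge0.
have y0 : 0 < x^-1 by rewrite invr_gt0.
rewrite ger0_norm; last by rewrite mulr_ge0 ?expR_ge0// exprn_ge0// ltW.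
have := @expR_ge1Dxn R x^-1 n.+1 (ltW y0).
move=> h; have {}h : x^-1 ^+ n.+2 / n.+2`!%:R <= expR x^-1.
  by apply: le_trans h; rewrite lerDr.
have f0 : 0 < n.+2`!%:R :> R by rewrite ltr0n fact_gt0.
rewrite ler_pdivrMr// in h.
rewrite expRN ler_pdivrMr ?expR_gt0//.
have -> : x^-1 ^+ n = x ^+ 2 * x^-1 ^+ n.+2.
  by rewrite !exprS expr0 mulr1; field; rewrite gt_eqF.
rewrite [leRHS]mulrAC [leRHS]mulrC ler_wpM2l ?exprn_even_ge0//.
by rewrite mulrC.
Qed.

Lemma is_derive_flat0 n : is_derive (0 : R) (1 : R) (flat n) (0 : R).
Proof.
have f0 : flat n 0 = 0 by rewrite /flat ltxx.
have L : h^-1 *: (flat n (h *: 1 + 0) - flat n 0) @[h --> (0 : R)^'] --> (0 : R).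
  apply/cvgr0Pnorm_le => e e0.
  near=> h.
  rewrite f0 subr0 addr0 /GRing.scale/= mulr1 normrM.
  have h0 : h != 0 by near: h; exact: nbhs_dnbhs_neq.
  rewrite normfV ler_pdivrMl ?normr_gt0//.
  apply: (le_trans (flat_le n h)).
  have -> : h ^+ 2 = `|h| * `|h| by rewrite -normrM -expr2 ger0_norm ?sqr_ge0.
  rewrite mulrCA ler_wpM2l// -ler_pdivlMl ?ltr0n ?fact_gt0//.
  near: h; apply: dnbhs0_le; rewrite mulr_gt0// invr_gt0 ltr0n fact_gt0//.
apply: DeriveDef.
  by apply/cvg_ex; exists 0.
exact: cvg_lim L.
Unshelve. all: by end_near. Qed.

Lemma is_derive_flat n x :
  is_derive x 1 (flat n) (- n%:R * flat n.+1 x + flat n.+2 x).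
Proof.
have [x0|x0|->] := ltgtP x 0.
- have -> : - n%:R * flat n.+1 x + flat n.+2 x = 0.
    by rewrite /flat ltNge (ltW x0)/= mulr0 addr0.
  apply: (near_eq_is_derive _ (is_derive_cst (0 : R) x (1 : R))).
  near=> y; rewrite /flat ltNge; case: ifP => // /negP[].
  by apply/ltW; near: y; exact: lt_nbhsl.
- have xn0 : x != 0 by rewrite gt_eqF.
  have dV : is_derive x 1 (fun y : R => y^-1) (- x ^- 2).
    have := @is_deriveV R id x 1 1 xn0 (is_derive_id _ _).
    by rewrite /GRing.scale/= mulr1.
  have dN : is_derive x 1 (fun y : R => - y^-1) (x ^- 2).
    by have := is_deriveN dV; rewrite opprK.
  have dE := @is_derive1_comp R expR (fun y => - y^-1) x _ _ (is_derive_expR _) dN.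
  have dX : is_derive x 1 (fun y : R => y^-1 ^+ n) (n%:R * x^-1 ^+ n.-1 * (- x ^- 2)).
    have -> : (fun y : R => y^-1 ^+ n) = (fun y : R => y^-1) ^+ n.
      by apply/funext => y; rewrite exprfctE.
    exact: (is_deriveX n dV).
  have dM := is_deriveM dX dE.
  apply: is_derive_eq.
    apply: (near_eq_is_derive _ dM).
    by near=> y; rewrite /flat ifT//; near: y; exact: lt_nbhsr.
  rewrite /GRing.scale/= /flat x0.
  rewrite -!exprVn; case: n {dX dM} => [|n].
    by rewrite !mul0r mulr0 addr0 oppr0 mul0r add0r !exprS expr0; ring.
  rewrite /= !exprS expr0; move: (x^-1 ^+ n) (expR _) => z E; ring.
- have f00 k : flat k 0 = 0 by rewrite /flat ltxx.
  by rewrite !f00 mulr0 addr0; exact: is_derive_flat0.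
Unshelve. all: by end_near. Qed.

Lemma times_derivable_flat k n : times_derivable k (flat n).
Proof.
elim: k n => [|k IH] n; apply: (times_derivableP (is_derive_flat n)) => //.
apply: times_derivableD => //; apply: times_derivableM => //.
exact: times_derivable_cst.
Qed.

Definition bump (r x : R) : R := flat 0 x * flat 0 (r - x).

Lemma times_derivable_bump k r : times_derivable k (bump r).
Proof.
apply: times_derivableM; first exact: times_derivable_flat.
have -> : (fun x => flat 0 (r - x)) = (fun x => flat 0 (-1 * x + r)).
  by apply/funext => x; rewrite mulN1r addrC.
by apply: times_derivable_affine; exact: times_derivable_flat.
Qed.

Lemma flat_ge0 n x : 0 <= flat n x.
Proof.
rewrite /flat; case: ltP => // x0.
by rewrite mulr_ge0 ?expR_ge0// exprn_ge0// invr_ge0 ltW.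
Qed.

Lemma bump_ge0 r x : 0 <= bump r x.
Proof. by rewrite mulr_ge0 ?flat_ge0. Qed.

Lemma bump_gt0 r x : 0 < x -> x < r -> 0 < bump r x.
Proof.
move=> x0 xr; have xr' : 0 < r - x by rewrite subr_gt0.
by rewrite /bump /flat x0 xr' !expr0 !mul1r mulr_gt0 ?expR_gt0.
Qed.

Lemma bump_out r x : x <= 0 \/ r <= x -> bump r x = 0.
Proof.
rewrite /bump /flat => -[x0|rx]; first by rewrite ltNge x0/= mul0r.
by rewrite subr_gt0 [x < r]ltNge rx/= mulr0.
Qed.

Lemma continuous_bump r : continuous (bump r).
Proof.
move=> x; apply: differentiable_continuous; apply/derivable1_diffP.
by have [] := times_derivable_bump 0 r.
Qed.

Local Notation mu := (@lebesgue_measure R).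

(** A smooth step, zero up to $0$ and constant from $r$ on. Starting at $-1$ adds no mass and makes
    $0$ an interior point for the fundamental theorem. *)
Definition bump_step (r x : R) : R := \int[mu]_(t in `[-1, x]) bump r t.

Lemma is_derive_bump_step r x : is_derive x 1 (bump_step r) (bump r x).
Proof.
have [x0|x0] := ltP x 0.
  rewrite bump_out; last by left; exact: ltW.
  apply: (near_eq_is_derive _ (is_derive_cst (0 : R) x (1 : R))).
  near=> y; rewrite /bump_step.
  transitivity (\int[mu]_(t in `[(-1)%R, y]) (0 : R)).
    by rewrite Rintegral_cst// mul0r.
  apply: eq_Rintegral => t; rewrite inE/= in_itv/= => /andP[_ ty].
  rewrite bump_out//; left; apply: (le_trans ty); apply/ltW.
  by near: y; exact: lt_nbhsl.
have x1 : -1 < x by lra.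
have [||d1 d2] := @continuous_FTC1_closed R (bump r) (-1) x (x + 1) _ _ x1
  (@continuous_bump r x).
- by rewrite ltrDl.
- apply: continuous_compact_integrable; first exact: segment_compact.
  by apply: continuous_subspaceT; exact: continuous_bump.
by apply: DeriveDef; [exact: d1|rewrite -derive1E; exact: d2].
Unshelve. all: by end_near. Qed.

Lemma times_derivable_bump_step k r : times_derivable k (bump_step r).
Proof.
apply: (times_derivableP (is_derive_bump_step r)).
by case: k => // k; exact: times_derivable_bump.
Qed.

Lemma continuous_bump_step r : continuous (bump_step r).
Proof.
move=> x; apply: differentiable_continuous; apply/derivable1_diffP.
by have [] := is_derive_bump_step r x.
Qed.

Lemma bump_step_MVT r x y : x <= y ->
  exists2 c, c \in `[x, y] & bump_step r y - bump_step r x = bump r c * (y - x).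
Proof.
move=> xy; apply: MVT_segment => //.
  by move=> z _; exact: is_derive_bump_step.
by apply: continuous_subspaceT; exact: continuous_bump_step.
Qed.

Lemma bump_step_le0 r x : x <= 0 -> bump_step r x = 0.
Proof.
have s0 y : y <= -1 -> bump_step r y = 0.
  rewrite /bump_step le_eqVlt => /predU1P[->|y1].
    by rewrite set_itv1 Rintegral_set1.
  by rewrite set_itv_ge ?Rintegral_set0// bnd_simp -ltNge.
move=> x0; have [/s0//|x1] := leP x (-1).
have [c] := bump_step_MVT r (ltW x1).
rewrite in_itv/= => /andP[_ cx]; rewrite (s0 _ (lexx _)) subr0 => ->.
by rewrite bump_out ?mul0r//; left; exact: le_trans x0.
Qed.

Lemma bump_step_ge r x : r <= x -> bump_step r x = bump_step r r.
Proof.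
move=> rx; have [c] := bump_step_MVT r rx.
rewrite in_itv/= => /andP[rc _]; rewrite bump_out ?mul0r; last by right.
by move/subr0_eq.
Qed.

Lemma bump_step_gt0 r : 0 < r -> 0 < bump_step r r.
Proof.
move=> r0; have [||c] := @MVT R (bump_step r) (bump r) 0 r r0.
- by move=> z _; exact: is_derive_bump_step.
- by apply: continuous_subspaceT; exact: continuous_bump_step.
rewrite in_itv/= => /andP[c0 cr]; rewrite (bump_step_le0 r (lexx 0)) !subr0 => ->.
by rewrite mulr_gt0// bump_gt0.
Qed.

End smooth_functions.

(** * The du Bois-Reymond lemma on a segment *)

Section uniqueness_of_primitive.
Context {R : realType}.
Variables (a b : R).
Hypothesis ab : a < b.
Local Notation mu := (@lebesgue_measure R).
Implicit Types (c d p r x : R) (F G H g phi : R -> R).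

Let is_derive_bump_step_sub r p x :
  is_derive x 1 (fun x => bump_step r (x - p)) (bump r (x - p)).
Proof.
have d1 : is_derive x 1 (fun x : R => x - p) 1.
  by have := is_deriveB (is_derive_id x (1 : R)) (is_derive_cst p x 1); rewrite subr0.
have := @is_derive1_comp R _ (fun x => x - p) x _ _ (is_derive_bump_step r (x - p)) d1.
by rewrite mulr1.
Qed.

Let is_derive_bump_step_diff r c d x :
  is_derive x 1 (fun x => bump_step r (x - c) - bump_step r (x - d))
    (bump r (x - c) - bump r (x - d)).
Proof.
exact: (is_deriveB (is_derive_bump_step_sub r c x) (is_derive_bump_step_sub r d x)).
Qed.

(** Beyond $d + r$ both steps have reached the same height and cancel, which leaves the support in
    $[c, d+r]$. *)
Lemma test_fun_bump_step r c d : 0 < r -> a < c -> c < d -> d + r < b ->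
  test_fun a b (fun x => bump_step r (x - c) - bump_step r (x - d)).
Proof.
move=> r0 ac cd drb; split.
  apply: times_derivable_derive1n => k.
  have sub p : (fun x => bump_step r (x - p)) = (fun x => bump_step r (1 * x + (- p))).
    by apply/funext => x; rewrite mul1r.
  have subN p : (fun x => - bump_step r (x - p)) =
      (fun x => (-1) * bump_step r (1 * x + (- p))).
    by apply/funext => x; rewrite mul1r mulN1r.
  apply: times_derivableD.
    by rewrite sub; apply: times_derivable_affine; exact: times_derivable_bump_step.
  rewrite subN; apply: times_derivableM; first exact: times_derivable_cst.
  by apply: times_derivable_affine; exact: times_derivable_bump_step.
exists c, (d + r); split => //; first by lra.
move=> x [xc|drx].
  by rewrite !bump_step_le0 ?subrr//; lra.
have h1 : r <= x - c by lra.
have h2 : r <= x - d by lra.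
by rewrite (bump_step_ge h1) (bump_step_ge h2) subrr.
Qed.

Lemma integrable_within_continuousM F G : {within `[a, b], continuous F} ->
  {within `[a, b], continuous G} -> L1 a b (fun x => F x * G x).
Proof.
move=> cF cG; apply: continuous_compact_integrable; first exact: segment_compact.
by move=> x; apply: cvgM; [exact: cF|exact: cG].
Qed.

Let continuous_bump_sub r p : {within `[a, b], continuous (fun x => bump r (x - p))}.
Proof.
apply: continuous_subspaceT => x.
apply: (@continuous_comp _ _ _ (fun x => x - p) (bump r)).
  by apply: cvgB; [exact: cvg_id|exact: cvg_cst].
exact: continuous_bump.
Qed.

Let within_continuous_cst p : {within `[a, b], continuous (fun=> p : R)}.
Proof. by apply: continuous_subspaceT => x; exact: cvg_cst. Qed.

Let integral_bump r p : 0 < r -> a < p -> p + r < b ->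
  \int[mu]_(x in `[a, b]) bump r (x - p) = bump_step r r.
Proof.
move=> r0 ap prb.
have cbs : continuous (fun x => bump_step r (x - p)).
  move=> x; apply: differentiable_continuous; apply/derivable1_diffP.
  by have [] := is_derive_bump_step_sub r p x.
rewrite /Rintegral (@continuous_FTC2 _ _ (fun x => bump_step r (x - p)) a b)//.
- rewrite -EFinB/= (@bump_step_le0 _ r (a - p)) ?subr0; last by lra.
  by rewrite bump_step_ge//; lra.
- split.
  + by move=> x _; have [] := is_derive_bump_step_sub r p x.
  + by apply: cvg_at_right_filter; exact: cbs.
  + by apply: cvg_at_left_filter; exact: cbs.
- by move=> x _; rewrite derive1E; have [_ ->] := is_derive_bump_step_sub r p x.
Qed.

(** The bump at [p] lives on $[p, p+r]$ and acts as an approximate unit; it is not normalised, so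
    its mass [bump_step r r] appears on both sides. *)
Let integral_bump_approx H r p e : {within `[a, b], continuous H} ->
  0 < r -> a < p -> p + r < b ->
  (forall x, p <= x <= p + r -> `|H x - H p| <= e) ->
  `|\int[mu]_(x in `[a, b]) (H x * bump r (x - p)) - H p * bump_step r r|
    <= e * bump_step r r.
Proof.
move=> cH r0 ap prb He.
have i1 := integrable_within_continuousM cH (@continuous_bump_sub r p).
have i2 := integrable_within_continuousM (@within_continuous_cst (H p))
  (@continuous_bump_sub r p).
have i3 := integrable_within_continuousM (@within_continuous_cst e)
  (@continuous_bump_sub r p).
have i0 : mu.-integrable `[a, b] (EFin \o (fun x => bump r (x - p))).
  apply: continuous_compact_integrable; first exact: segment_compact.
  exact: continuous_bump_sub.
rewrite -(integral_bump r0 ap prb) -!RintegralZl// -RintegralB//.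
have i12 : mu.-integrable `[a, b]
    (fun x => (H x * bump r (x - p))%:E - (H p * bump r (x - p))%:E)%E.
  exact: integrableB.
apply: (le_trans (le_normr_Rintegral _ _)) => //.
apply: le_Rintegral => //.
  by have := integrable_norm i12; apply: eq_integrable.
move=> x _; rewrite -mulrBl normrM (ger0_norm (bump_ge0 _ _)).
have [/He xp|xp] := boolP (p <= x <= p + r).
  by rewrite ler_wpM2r ?bump_ge0.
rewrite bump_out ?mulr0//; move: xp; rewrite negb_and -!ltNge => /orP[?|?].
  by left; lra.
by right; lra.
Qed.

Let interior_continuous H c : {within `[a, b], continuous H} -> a < c -> c < b ->
  {for c, continuous H}.
Proof.
move=> cH ac cb; have [h _ _] := (continuous_within_itvP _ ab).1 cH.
by apply: h; rewrite in_itv/= ac.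
Qed.

(* Test against a primitive of the difference of two translates of a thin bump,
   centred near [c] and near [d]. *)
Lemma constant_of_weak_derivative0 H : {within `[a, b], continuous H} ->
  (forall phi, test_fun a b phi ->
     \int[mu]_(x in `[a, b]) (H x * derive1 phi x) = 0) ->
  forall c d, a < c -> c < d -> d < b -> H c = H d.
Proof.
move=> cH H0 c d ac cd db; apply/eqP; rewrite -subr_eq0 -normr_le0.
apply/ler_addgt0Pr => e e0; rewrite add0r.
have e2 : 0 < e / 2 by rewrite divr_gt0.
have /cvgrPdist_le /(_ _ e2) /nbhs_ballP[r1 /= r10 Hr1] :=
  interior_continuous cH ac (lt_trans cd db).
have /cvgrPdist_le /(_ _ e2) /nbhs_ballP[r2 /= r20 Hr2] :=
  interior_continuous cH (lt_trans ac cd) db.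
(* Halving gives strict inequalities: both supports stay in the open balls of continuity, and $d + r
   < b$. *)
pose r := Num.min (Num.min r1 r2) (b - d) / 2.
have m0 : 0 < Num.min (Num.min r1 r2) (b - d) by rewrite !lt_min r10 r20 subr_gt0.
have r0 : 0 < r by rewrite divr_gt0.
have rm : r < Num.min (Num.min r1 r2) (b - d) by rewrite /r; lra.
move: rm; rewrite !lt_min => /andP[/andP[rr1 rr2] rbd].
have drb : d + r < b by lra.
have Hc x : c <= x <= c + r -> `|H x - H c| <= e / 2.
  move=> /andP[x1 x2]; rewrite distrC; apply: Hr1; rewrite /ball/=.
  by rewrite ltr_norml; apply/andP; split; lra.
have Hd x : d <= x <= d + r -> `|H x - H d| <= e / 2.
  move=> /andP[x1 x2]; rewrite distrC; apply: Hr2; rewrite /ball/=.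
  by rewrite ltr_norml; apply/andP; split; lra.
have crb : c + r < b by lra.
have ad : a < d by lra.
have Ec := integral_bump_approx cH r0 ac crb Hc.
have Ed := integral_bump_approx cH r0 ad drb Hd.
have := H0 _ (test_fun_bump_step r0 ac cd drb).
rewrite (_ : \int[mu]_(x in _) _ = \int[mu]_(x in `[a, b]) (H x * bump r (x - c))
   - \int[mu]_(x in `[a, b]) (H x * bump r (x - d))); last first.
  rewrite -RintegralB//; [|exact: integrable_within_continuousM..].
  apply: eq_Rintegral => x _; rewrite -mulrBr derive1E.
  by have [_ ->] := is_derive_bump_step_diff r c d x.
move/subr0_eq => E; rewrite E in Ec.
have I0 := bump_step_gt0 r0.
rewrite -(ler_pM2r I0) -[X in _ * X](ger0_norm (ltW I0)) -normrM mulrBl.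
move: Ec Ed; rewrite !ler_norml => /andP[E1 E2] /andP[E3 E4].
by apply/andP; split; clear -E1 E2 E3 E4; lra.
Qed.

(** Constancy is known only inside $]a,b[$; one-sided continuity at $a$ identifies the constant as
    $H(a) = 0$, and at $b$ carries it to the end point. *)
Lemma zero_of_weak_derivative0 H : in_C0 a b H ->
  (forall phi, test_fun a b phi ->
     \int[mu]_(x in `[a, b]) (H x * derive1 phi x) = 0) ->
  forall x, x \in `[a, b] -> H x = 0.
Proof.
move=> [cH Ha] H0.
have [_ ra lb] := (continuous_within_itvP _ ab).1 cH.
have Hcst := constant_of_weak_derivative0 cH H0.
pose m := (a + b) / 2; have am : a < m by rewrite /m; move: ab; lra.
have mb : m < b by rewrite /m; move: ab; lra.
have Hm x : a < x -> x < b -> H x = H m.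
  move=> ax xb; have [xm|mx|->//] := ltgtP x m; first exact: Hcst.
  by apply/esym; exact: Hcst.
have Hm0 : H m = 0.
  have L : H x @[x --> a^'+] --> H m.
    apply: cvg_near_cst; near=> x; apply: Hm; first by near: x; exact: nbhs_right_gt.
    by near: x; exact: nbhs_right_lt.
  by rewrite -Ha; exact: (cvg_unique _ L ra).
move=> x; rewrite in_itv/= => /andP[]; rewrite le_eqVlt => /predU1P[<- //|ax].
rewrite le_eqVlt => /predU1P[->|xb]; last by rewrite Hm.
have L : H x @[x --> b^'-] --> H m.
  apply: cvg_near_cst; near=> y; apply: Hm; first by near: y; exact: nbhs_left_gt.
  by near: y; exact: nbhs_left_lt.
by rewrite -Hm0; exact: (cvg_unique _ lb L).
Unshelve. all: by end_near. Qed.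

Lemma test_fun_continuous_derive1 phi : test_fun a b phi -> continuous (derive1 phi).
Proof.
move=> [dphi _] x; apply: differentiable_continuous; apply/derivable1_diffP.
exact: (dphi 1%N x).
Qed.

Lemma is_primitive_unique (f : distr R) F G : is_primitive a b f F ->
  is_primitive a b f G -> forall x, x \in `[a, b] -> F x = G x.
Proof.
move=> [[cF Fa] DF] [[cG Ga] DG] x xab; apply/eqP; rewrite -subr_eq0; apply/eqP.
apply: (@zero_of_weak_derivative0 (fun x => F x - G x)) => //.
  split; last by rewrite Fa Ga subrr.
  by move=> y; apply: cvgB; [exact: cF|exact: cG].
move=> phi tphi.
have cphi : {within `[a, b], continuous (derive1 phi)}.
  by apply: continuous_subspaceT; exact: test_fun_continuous_derive1.
rewrite (_ : \int[mu]_(x in _) _ = \int[mu]_(x in `[a, b]) (F x * derive1 phi x)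
   - \int[mu]_(x in `[a, b]) (G x * derive1 phi x)); last first.
  rewrite -RintegralB//; [|exact: integrable_within_continuousM..].
  by apply: eq_Rintegral => y _; rewrite mulrBl.
have := DF _ tphi; rewrite -(DG _ tphi) /Ddistr => /oppr_inj ->.
by rewrite subrr.
Qed.

(** The chosen primitive is arbitrary outside $[a,b]$, so it is only ever handled through this
    pointwise comparison. *)
Lemma primitiveE (f : distr R) F : is_primitive a b f F ->
  forall x, x \in `[a, b] -> primitive a b f x = F x.
Proof.
move=> fF; apply: (is_primitive_unique (f := f)) => //.
by rewrite /primitive; case: xgetP => [G -> //|/(_ F)].
Qed.

End uniqueness_of_primitive.

(** * Fractional integrals in D_HK *)

Section primitives_of_integrable_functions.
Context {R : realType}.
Variables (a b : R).
Hypothesis ab : a < b.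
Local Notation mu := (@lebesgue_measure R).
Implicit Types (m n x t : R) (f g F G phi : R -> R).

(* Evaluate [K_1 * K_n = K_(1 + n)] at [1]. *)
Lemma invr_GammaS n : 0 < n -> (Gamma (1 + n))^-1 = (Gamma n)^-1 / n.
Proof.
move=> n0; have G0 := Gamma_gt0 n0.
have := @frac_kernel_conv R 1 n 1 ltr01 n0.
have -> : frac_kernel (1 + n) 1 = (Gamma (1 + n))^-1.
  by rewrite /frac_kernel /pow_kernel ltr01 powR1 mulr1.
have -> : (\int[mu]_v (frac_kernel 1 (1 - v) * frac_kernel n v)%:E =
   ((Gamma n)^-1)%:E * \int[mu]_(v in `]0%R, 1%R]) (v `^ (n - 1))%:E)%E.
  rewrite -ge0_integralZl_EFin//; last 3 first.
  - by move=> v _; rewrite lee_fin powR_ge0.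
  - by apply: measurable_funTS; exact: measurable_fun_powR_subr.
  - by rewrite invr_ge0 ltW.
  rewrite -integral_itv_bndo_bndc; last first.
    apply: measurable_funTS; apply/measurable_EFinP.
    by apply: measurable_funM => //; exact: measurable_powR.
  rewrite [RHS]integral_mkcond; apply: eq_integral => v _.
  rewrite patchE mem_setE in_itv/=.
  have [v0|v0] := ltP 0 v; last by rewrite (frac_kernel_le0 n v0) mulr0.
  have [v1|v1] := ltP v 1 => /=.
    by rewrite frac_kernel1 ?subr_gt0// mul1r /frac_kernel /pow_kernel v0 EFinM.
  by rewrite frac_kernel_le0 ?mul0r// subr_le0.
by rewrite integral_powR_oc// powR1 -EFinM => -[<-]; rewrite mul1r.
Qed.

(* Fubini for [phi'(x) 1_(t < x) g(t)]. *)
Lemma weak_derivative_L1 g phi : L1 a b g -> test_fun a b phi ->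
  - (\int[mu]_(x in `[a, b]) (RLcl a 1 g x * derive1 phi x)) =
  \int[mu]_(x in `[a, b]) (g x * phi x).
Proof.
move=> ig tphi; set dphi := derive1 phi.
have cdphi : continuous dphi := test_fun_continuous_derive1 tphi.
have cdphi' : {within `[a, b], continuous dphi} by exact: continuous_subspaceT.
have [M dphiM] := within_continuous_bounded ab cdphi'.
have mg : measurable_fun `[a, b] g by case/integrableP: ig => /measurable_EFinP.
pose h := g \_ `[a, b].
have mh : measurable_fun setT h by exact/(measurable_restrictT _ _).1.
have ih : mu.-integrable setT (EFin \o h).
  by rewrite -restrict_EFin; apply/integrable_restrict => //; rewrite setTI.
pose psi := dphi \_ `[a, b].
have mpsi : measurable_fun setT psi.
  apply/(measurable_restrictT _ _).1 => //.
  exact: within_continuous_measurable.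
pose I := (cst M : R -> R) \_ `[a, b].
have mI : measurable_fun setT I by apply/(measurable_restrictT _ _).1.
have M0 : 0 <= M by apply: le_trans (dphiM a _) => //; rewrite in_itv/= lexx ltW.
have psiI x : `|psi x| <= I x.
  by rewrite /psi /I !patchE mem_setE; case: ifPn => [/dphiM //|_]; rewrite normr0.
have I0 x : 0 <= I x by apply: le_trans (psiI x).
have K1 u : 0 <= frac_kernel (1 : R) u <= 1.
  have [u0|u0] := ltP 0 u; first by rewrite frac_kernel1// ler01 lexx.
  by rewrite frac_kernel_le0// lexx ler01.
pose f (p : measurableTypeR R * measurableTypeR R) : \bar R :=
  (psi p.1 * (frac_kernel 1 (p.1 - p.2) * h p.2))%:E.
have mf : measurable_fun setT f.
  apply/measurable_EFinP; apply: measurable_funM.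
    exact: (measurableT_comp mpsi measurable_fst).
  apply: measurable_funM.
    apply: (measurableT_comp (@measurable_frac_kernel R 1)).
    by apply: measurable_funB; [exact: measurable_fst|exact: measurable_snd].
  exact: (measurableT_comp mh measurable_snd).
have intI : (\int[mu]_x (I x)%:E = (M * (b - a))%:E)%E.
  rewrite /I; transitivity (\int[mu]_(x in `[a, b]) (M%:E))%E.
    by rewrite [RHS]integral_mkcond; apply: eq_integral => x _;
      rewrite !patchE; case: ifP.
  rewrite integral_cst//= lebesgue_measure_itv/= lte_fin ab.
  by rewrite -EFinB -EFinM.
(* Since $0 \le K_1 \le 1$, the integrand is at most $I(x)|h(t)|$, a product of integrable
   functions. *)
have iF : (mu \x mu)%E.-integrable setT f.
  apply/(integrable21ltyP _ _ mf).
  have /integrableP[_ ihoo] := integrableZl measurableT (M * (b - a)) ih.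
  apply: le_lt_trans ihoo; apply: ge0_le_integral => //.
  - by move=> t _; exact: integral_ge0.
  - apply: (measurable_fun_fubini_tonelli_G (abse \o f)).
      exact: measurableT_comp.
    by move=> p; exact: abse_ge0.
  - by apply: measurableT_comp => //; apply: measurable_funeM; exact/measurable_EFinP.
  - move=> t _; rewrite abseM -intI gee0_abs; last first.
      by apply: integral_ge0 => x _; rewrite lee_fin.
    rewrite -ge0_integralZr//.
    - apply: ge0_le_integral => //.
      + apply: measurableT_comp => //; apply: (measurableT_comp mf).
        exact: pair2_measurable.
      + by apply/measurable_EFinP; apply: measurable_funM.
      + move=> x _; rewrite /f/= lee_fin normrM ler_pM//.
        rewrite normrM; have /andP[k0 k1] := K1 (x - t).
        by rewrite ger0_norm// ler_piMl.
    - exact/measurable_EFinP.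
    - by move=> x _; rewrite lee_fin.
have L : (\int[mu]_x \int[mu]_t f (x, t) =
    \int[mu]_(x in `[a, b]) (RLcl a 1 g x * dphi x)%:E)%E.
  rewrite [RHS]integral_mkcond; apply: eq_integral => x _.
  rewrite /f/= patchE mem_setE; case: ifPn => [xab|xab]; last first.
    rewrite /psi patchE mem_setE (negbTE xab).
    by under eq_integral do rewrite mul0r; rewrite integral0.
  have i2 : mu.-integrable setT (fun t => (frac_kernel 1 (x - t) * h t)%:E).
    apply: integrable_frac_kernel_L1 => //.
    by move: xab; rewrite in_itv/= => /andP[].
  under eq_integral do rewrite EFinM.
  rewrite integralZl// (RLclE ltr01 xab mg) /frac_conv /Rintegral.
  rewrite mulrC EFinM fineK; last exact: integrable_fin_num.
  by rewrite /psi patchE mem_setE xab.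
have phi0 x : x < a \/ b <= x -> phi x = 0.
  move=> xab; have [_ [c [d [ac cd db H]]]] := tphi; apply: H.
  by case: xab => ?; [left|right]; lra.
have dP x : is_derive x 1 phi (dphi x).
  have [dphi0 _] := tphi.
  by apply: DeriveDef; [exact: (dphi0 0%N x)|rewrite -derive1E].
have cP : continuous phi.
  move=> x; apply: differentiable_continuous; apply/derivable1_diffP.
  by have [] := dP x.
(* The inner integral is that of $\phi'$ over $]t,b]$, equal to $-\phi(t)$ because $\phi(b) = 0$. *)
have Rr : (\int[mu]_t \int[mu]_x f (x, t) =
    \int[mu]_(t in `[a, b]) (- (g t * phi t))%:E)%E.
  rewrite [RHS]integral_mkcond; apply: eq_integral => t _.
  rewrite /f/= patchE mem_setE; case: ifPn => [tab|tab]; last first.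
    rewrite /h patchE mem_setE (negbTE tab).
    by under eq_integral do rewrite !mulr0; rewrite integral0.
  have ht : h t = g t by rewrite /h patchE mem_setE tab.
  rewrite ht.
  move: (tab); rewrite in_itv/= => /andP[at_ tb].
  have i1 : mu.-integrable `[t, b] (EFin \o dphi).
    apply: continuous_compact_integrable; first exact: segment_compact.
    exact: continuous_subspaceT.
  transitivity (\int[mu]_(x in `]t, b]) ((dphi x)%:E * (g t)%:E))%E.
    rewrite [RHS]integral_mkcond; apply: eq_integral => x _.
    rewrite /psi !patchE !mem_setE !in_itv/=.
    have [tx|tx] := ltP t x => /=; last first.
      by rewrite frac_kernel_le0 ?mul0r ?mulr0// subr_le0.
    rewrite (le_trans at_ (ltW tx))/=; case: ifP => _; last by rewrite mul0r.
    by rewrite frac_kernel1 ?subr_gt0// mul1r EFinM.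
  rewrite integralZr//; last first.
    by apply: integrableS i1 => //; exact: subset_itv_oc_cc.
  rewrite integral_itv_obnd_cbnd; last first.
    apply: measurable_funTS; apply/measurable_EFinP.
    exact: continuous_measurable_fun.
  move: tb; rewrite le_eqVlt => /predU1P[->|tb].
    by rewrite set_itv1 integral_set1 mul0e phi0 ?mulr0 ?oppr0//; right.
  rewrite (@continuous_FTC2 _ dphi phi t b)//.
  - rewrite [phi b]phi0; last by right.
    by rewrite sub0e -EFinN -EFinM mulNr mulrC.
  - exact: continuous_subspaceT.
  - split => //.
    + by apply: cvg_at_right_filter; exact: cP.
    + by apply: cvg_at_left_filter; exact: cP.
have := Fubini iF; rewrite L Rr /Rintegral => ->.
have igp : mu.-integrable `[a, b] (fun t => (g t * phi t)%:E).
  have cP' : {within `[a, b], continuous phi} by exact: continuous_subspaceT.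
  have [N phiN] := within_continuous_bounded ab cP'.
  have : mu.-integrable `[a, b] (fun t => (EFin \o g) t * N%:E)%E.
    exact: integrableZr.
  apply: le_integrable => //.
    apply/measurable_EFinP; apply: measurable_funM => //.
    exact: within_continuous_measurable.
  move=> t /= tab; rewrite lee_fin !normrM ler_wpM2l//.
  by rewrite (le_trans (phiN t tab))// ler_norm.
have -> : (\int[mu]_(t in `[a, b]) (- (g t * phi t))%:E =
    (-1)%:E * \int[mu]_(t in `[a, b]) (g t * phi t)%:E)%E.
  rewrite -integralZl//; apply: eq_integral => t _.
  by rewrite -EFinM mulN1r.
by rewrite EFinN mulN1e fineN opprK.
Qed.

Lemma in_C0_RLcl1 g : L1 a b g -> in_C0 a b (RLcl a 1 g).
Proof.
move=> ig; split; last by rewrite RLcl1 set_itv1 Rintegral_set1.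
have -> : RLcl a 1 g = fun x => parameterized_integral mu a x g.
  by apply/funext => x; rewrite RLcl1.
by apply: parameterized_integral_continuous => //; exact: ltW.
Qed.

Lemma is_primitive_regdist g : L1 a b g ->
  is_primitive a b (regdist a b g) (RLcl a 1 g).
Proof.
by move=> ig; split; [exact: in_C0_RLcl1|move=> phi; exact: weak_derivative_L1].
Qed.

Lemma RLcl0 g x : RLcl a 0 g x = g x.
Proof. by rewrite /RLcl eqxx. Qed.

Lemma RLcl_semigroup m n F x : 0 <= m -> 0 <= n -> in_C0 a b F -> x \in `[a, b] ->
  RLcl a m (RLcl a n F) x = RLcl a (m + n) F x.
Proof.
rewrite le_eqVlt => /predU1P[<-|m0]; first by rewrite RLcl0 add0r.
rewrite le_eqVlt => /predU1P[<-|n0] [cF _] xab.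
  by rewrite addr0; congr (RLcl _ _ _ _); apply/funext => y; rewrite RLcl0.
have [A FA] := within_continuous_bounded ab cF.
by apply: RLcl_RLcl_bounded FA => //; exact: within_continuous_measurable.
Qed.

Lemma eq_RLcl n f g x : x \in `[a, b] ->
  (forall t, t \in `[a, b] -> f t = g t) -> RLcl a n f x = RLcl a n g x.
Proof.
move=> xab fg; rewrite /RLcl; case: ifP => _; first exact: fg.
congr (_ * _); apply: eq_Rintegral => t; rewrite inE/= => tax.
rewrite fg//; move: xab tax; rewrite !in_itv/= => /andP[_ xb] /andP[-> tx].
exact: le_trans xb.
Qed.

(** For $n > 1$ the boundary term vanishes and $-\frac{d}{dt}(x-t)^{n-1} = (n-1)(x-t)^{n-2}$, whose
    factor is absorbed by $\Gamma(n) = (n-1)\Gamma(n-1)$. For $n = 1$ the weight is constant, with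
    $0^0 = 1$, and the boundary term $F(x)$ is the whole value. *)
Lemma RLfunE n (f : distr R) F x : 1 <= n -> is_primitive a b f F ->
  x \in `[a, b] -> RLfun a b n f x = RLcl a (n - 1) F x.
Proof.
move=> n1 fF xab; have pF := primitiveE ab fF.
have n0 : 0 < n by exact: lt_le_trans n1.
have [[cF Fa] _] := fF.
have mF := within_continuous_measurable cF.
move: (xab); rewrite in_itv/= => /andP[ax xb].
have sub t : t \in `[a, x] -> t \in `[a, b].
  by rewrite !in_itv/= => /andP[-> tx]; exact: le_trans xb.
rewrite /RLfun /hk_int_mul pF// subrr.
have [n1'|n1'] := eqVneq n 1.
  rewrite n1' Gamma1 invr1 mul1r subrr powRr0 mulr1 RLcl0.
  rewrite (_ : \int[mu]_(t in _) _ = 0) ?subr0//.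
  transitivity (\int[mu]_(t in `[a, x]) (0 : R)); last by rewrite Rintegral_cst// mul0r.
  apply: eq_Rintegral => t _.
  rewrite (_ : (fun t => _) = cst 1) ?derive1_cst ?mulr0//.
  by apply/funext => u; rewrite powRr0.
have p0 : 0 < n - 1 by rewrite subr_gt0 lt_neqAle eq_sym n1'.
rewrite powR0 ?gt_eqF// mulr0 sub0r /RLcl gt_eqF//.
have -> : (Gamma (n - 1))^-1 = (Gamma n)^-1 * (n - 1).
  have := invr_GammaS p0; rewrite addrC subrK => ->.
  by rewrite divfK// gt_eqF.
rewrite -mulrA; congr (_ * _).
pose p := n - 1; pose k t := (x - t) `^ (p - 1) * F t.
have Gp := Gamma_gt0 p0.
have ik : mu.-integrable `[a, x[ (EFin \o k).
  have [A FA] := within_continuous_bounded ab cF.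
  have i1 := integrable_frac_kernel_bounded x p0 mF FA.
  have i2 : mu.-integrable `[a, x[
      (fun t => (Gamma p)%:E * (frac_kernel p (x - t) * (F \_ `[a, b]) t)%:E)%E.
    by apply: integrableS (integrableZl measurableT (Gamma p) i1).
  apply: eq_integrable i2 => // t; rewrite inE/= in_itv/= => /andP[at_ tx].
  rewrite patchE mem_setE in_itv/= at_ (le_trans (ltW tx) xb)/=.
  rewrite /frac_kernel /pow_kernel subr_gt0 tx -EFinM /k; congr EFin.
  by rewrite !mulrA divff ?mul1r// gt_eqF.
have dk t : t < x -> derive1 (fun t => (x - t) `^ p) t = - p * (x - t) `^ (p - 1).
  move=> tx; have xt0 : 0 < x - t by rewrite subr_gt0.
  have d1 : is_derive t 1 (fun t : R => x - t) (-1).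
    by have := is_deriveB (is_derive_cst x t (1 : R)) (is_derive_id t (1 : R));
      rewrite sub0r.
  have d2 : is_derive (x - t) 1 (@powR R ^~ p) (p * (x - t) `^ (p - 1)).
    exact: is_derive1_powR.
  have [_] := @is_derive1_comp R (@powR R ^~ p) (fun t => x - t) t _ _ d2 d1.
  by rewrite derive1E => ->; rewrite mulrN1 mulNr.
have Fdk : {in `[a, x[%classic,
    (fun t => - p * k t) =1 (fun t => F t * derive1 (fun t => (x - t) `^ p) t)}.
  move=> t; rewrite inE/= in_itv/= => /andP[_ tx].
  by rewrite dk// /k; ring.
have ipk : mu.-integrable `[a, x[ (EFin \o (fun t => - p * k t)).
  have -> : EFin \o (fun t => - p * k t) = (fun t => (- p)%:E * (EFin \o k) t)%E by [].
  exact: integrableZl.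
have iFd : mu.-integrable `[a, x[
    (EFin \o (fun t => F t * derive1 (fun t => (x - t) `^ p) t)).
  by apply: eq_integrable ipk => // t tx; congr EFin; exact: Fdk.
have -> : \int[mu]_(t in `[a, x])
      (primitive a b f t * derive1 (fun t => (x - t) `^ p) t)
    = \int[mu]_(t in `[a, x]) (F t * derive1 (fun t => (x - t) `^ p) t).
  by apply: eq_Rintegral => t; rewrite inE/= => /sub tab; rewrite pF.
(* The derivative formula [dk] covers only $t < x$, so the end point is dropped from both
   integrals. *)
rewrite -(Rintegral_itv_bndo_bndc iFd) -(Rintegral_itv_bndo_bndc ik).
have -> : \int[mu]_(t in `[a, x[) (F t * derive1 (fun t => (x - t) `^ p) t) =
    \int[mu]_(t in `[a, x[) (- p * k t).
  by apply: eq_Rintegral => t tx; rewrite Fdk.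
by rewrite RintegralZl// mulNr opprK.
Qed.

End primitives_of_integrable_functions.

(** * Derivatives of continuous functions as distributions, and the Alexiewicz norm *)

Section distributions.
Context {R : realType}.
Variables (a b : R).
Hypothesis ab : a < b.
Local Notation mu := (@lebesgue_measure R).
Implicit Types (m n x e : R) (F G phi psi : R -> R) (S T f : distr R).

Let derive1n_times_derivable phi :
  (forall (k : nat) x, derivable (derive1n k phi) x 1) ->
  forall k, times_derivable k phi.
Proof.
move=> H k; elim: k phi H => [|k IH] phi H; first by split=> // x; exact: (H 0%N x).
split; first by move=> x; exact: (H 0%N x).
by apply: IH => j x; have := H j.+1 x; rewrite /derive1n iterSr.
Qed.

Lemma test_funD phi psi : test_fun a b phi -> test_fun a b psi ->
  test_fun a b (phi \+ psi).
Proof.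
move=> [p1 [c1 [d1 [ac1 cd1 db1 H1]]]] [p2 [c2 [d2 [ac2 cd2 db2 H2]]]]; split.
  apply: times_derivable_derive1n => k.
  by apply: times_derivableD; exact: derive1n_times_derivable.
exists (Num.min c1 c2), (Num.max d1 d2); split.
- by rewrite lt_min ac1.
- by rewrite ge_min le_max cd1.
- by rewrite gt_max db1.
- move=> x; rewrite lt_min gt_max => xcd /=.
  by rewrite H1 ?H2 ?addr0//; case: xcd => /andP[? ?]; [left|right|left|right].
Qed.

Lemma test_funZ (c : R) phi : test_fun a b phi -> test_fun a b (fun x => c * phi x).
Proof.
move=> [p1 [c1 [d1 [ac1 cd1 db1 H1]]]]; split.
  apply: times_derivable_derive1n => k.
  apply: times_derivableM; first exact: times_derivable_cst.
  exact: derive1n_times_derivable.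
by exists c1, d1; split => // x /H1 ->; rewrite mulr0.
Qed.

Let derive1_support phi c d : (forall x, x < c \/ d < x -> phi x = 0) ->
  forall x, x < c \/ d < x -> derive1 phi x = 0.
Proof.
move=> H x xcd; rewrite derive1E.
have -> : 'D_1 phi x = 'D_1 (cst 0 : R -> R) x.
  apply: near_eq_derive; case: xcd => xcd; near=> y; apply: H.
    by left; near: y; exact: lt_nbhsl.
  by right; near: y; exact: lt_nbhsr.
by rewrite derive_cst.
Unshelve. all: by end_near. Qed.

(** Guards against the default value of [sup] on unbounded sets: the derivatives are continuous and
    vanish off a compact subinterval. *)
Lemma derive1n_has_ubound phi k : test_fun a b phi ->
  has_ubound (range (fun x => `|derive1n k phi x|)).
Proof.
move=> [dphi [c [d [ac cd db H]]]].
have supp j : forall x, x < c \/ d < x -> derive1n j phi x = 0.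
  by elim: j => [//|j IH] x xcd; rewrite derive1nS; exact: derive1_support IH x xcd.
have cphi : continuous (derive1n k phi).
  by move=> x; apply: differentiable_continuous; apply/derivable1_diffP.
have [A HA] := within_continuous_bounded ab (continuous_subspaceT (A := `[a, b]) cphi).
exists A => _ [x _ <-].
have A0 : 0 <= A by apply: le_trans (HA a _) => //; rewrite in_itv/= lexx ltW.
have [xab|xab] := boolP (x \in `[a, b]); first exact: HA.
rewrite supp ?normr0//; move: xab; rewrite in_itv/= negb_and -!ltNge => /orP[?|?].
  by left; lra.
by right; lra.
Qed.

Lemma norm_le_sup_derive1n phi k x : test_fun a b phi ->
  `|derive1n k phi x| <= sup (range (fun x => `|derive1n k phi x|)).
Proof. by move=> tphi; apply: ub_le_sup; [exact: derive1n_has_ubound|exists x]. Qed.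

Let integrable_derive1M F phi : {within `[a, b], continuous F} ->
  test_fun a b phi -> L1 a b (fun x => F x * derive1 phi x).
Proof.
move=> cF tphi; apply: integrable_within_continuousM => //.
by apply: continuous_subspaceT; exact: test_fun_continuous_derive1 tphi.
Qed.

Lemma is_distribution_Ddistr F : {within `[a, b], continuous F} ->
  is_distribution a b (Ddistr a b F).
Proof.
move=> cF; split.
- move=> phi psi tphi tpsi; rewrite /Ddistr -opprD -RintegralD//;
    [|exact: integrable_derive1M..].
  congr (- _); apply: eq_Rintegral => x _; rewrite -mulrDr; congr (_ * _).
  have [p1 _] := tphi; have [p2 _] := tpsi.
  by rewrite !derive1E deriveD//; [exact: (p1 0%N x)|exact: (p2 0%N x)].
- move=> c phi tphi; rewrite /Ddistr mulrN -RintegralZl//;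
    last exact: integrable_derive1M.
  congr (- _); apply: eq_Rintegral => x _; rewrite mulrCA; congr (_ * _).
  have [p1 _] := tphi; have d1 := p1 0%N x.
  by rewrite !derive1E (_ : (fun x => c * phi x) = c \*: phi)// deriveZ.
(* The order is at most one: $|\int F\phi'| \le \|F\|_1 \sup|\phi'|$. With [N = 1] the sum has the
   terms $k = 0, 1$, and the first is non-negative. *)
move=> c d _ _; exists (\int[mu]_(x in `[a, b]) `|F x|), 1%N => phi tphi _.
have iF : mu.-integrable `[a, b] (EFin \o F).
  by apply: continuous_compact_integrable => //; exact: segment_compact.
have inF : mu.-integrable `[a, b] (EFin \o (fun x => `|F x|)).
  by have := integrable_norm iF; apply: eq_integrable.
have iFp := integrable_derive1M cF tphi.
set s := sup (range (fun x => `|derive1n 1 phi x|)).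
have sp x : `|derive1 phi x| <= s by exact: (@norm_le_sup_derive1n phi 1 x tphi).
apply: (@le_trans _ _ ((\int[mu]_(x in `[a, b]) `|F x|) * s)).
  rewrite /Ddistr normrN; apply: (le_trans (le_normr_Rintegral _ iFp)) => //.
  rewrite -RintegralZr//; apply: le_Rintegral => //.
  - by have := integrable_norm iFp; apply: eq_integrable.
  - have -> : EFin \o (fun x => `|F x| * s) =
        (fun x => (EFin \o (fun x => `|F x|%R)) x * s%:E)%E by [].
    exact: integrableZr.
  - by move=> x _; rewrite normrM ler_wpM2l.
apply: ler_wpM2l; first by apply: Rintegral_ge0.
rewrite big_ord_recr big_ord1/= lerDr.
exact: le_trans (norm_le_sup_derive1n 0 0 tphi).
Qed.

Lemma is_primitive_DHK f F : is_primitive a b f F -> DHK a b f.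
Proof.
move=> fF; split; last by exists F.
have [[cF Fa] Df] := fF; have [D1 D2 D3] := is_distribution_Ddistr cF.
split.
- by move=> phi psi tp ts; rewrite -!Df//; [exact: D1|exact: test_funD].
- by move=> c phi tp; rewrite -!Df//; [exact: D2|exact: test_funZ].
- move=> c d ac db; have [C [N H]] := D3 c d ac db; exists C, N => phi tp s.
  by rewrite -Df//; exact: H.
Qed.

Lemma eq_Ddistr F G phi : (forall x, x \in `[a, b] -> F x = G x) ->
  Ddistr a b F phi = Ddistr a b G phi.
Proof.
move=> FG; congr (- _); apply: eq_Rintegral => x; rewrite inE/= => xab.
by rewrite FG.
Qed.

Lemma is_primitive_eq f F G : is_primitive a b f F ->
  (forall x, x \in `[a, b] -> F x = G x) -> is_primitive a b f G.
Proof.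
move=> [[cF Fa] Df] FG; split.
  split; last by rewrite -FG// in_itv/= lexx ltW.
  by apply: subspace_eq_continuous cF => x; rewrite inE/= => xab; exact: FG.
by move=> phi tp; rewrite -(eq_Ddistr phi FG); exact: Df.
Qed.

Lemma is_primitive_distr_eq S T F : is_primitive a b S F ->
  distr_eq a b S T -> is_primitive a b T F.
Proof. by move=> [CF D] ST; split => // phi tp; rewrite -ST// D. Qed.

Lemma distr_eq_primitive S T F G : is_primitive a b S F -> is_primitive a b T G ->
  (forall x, x \in `[a, b] -> F x = G x) -> distr_eq a b S T.
Proof.
by move=> [_ DS] [_ DT] FG phi tp; rewrite -DS// -DT//; exact: eq_Ddistr.
Qed.

Lemma is_primitiveB S T F G : is_primitive a b S F -> is_primitive a b T G ->
  is_primitive a b (distr_sub S T) (fun x => F x - G x).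
Proof.
move=> [[cF Fa] DS] [[cG Ga] DT]; split.
  split; last by rewrite Fa Ga subrr.
  by move=> x; apply: cvgB; [exact: cF|exact: cG].
move=> phi tp; rewrite /distr_sub -DS// -DT// /Ddistr.
have -> : \int[mu]_(x in `[a, b]) ((F x - G x) * derive1 phi x) =
    \int[mu]_(x in `[a, b]) (F x * derive1 phi x) -
    \int[mu]_(x in `[a, b]) (G x * derive1 phi x).
  rewrite -RintegralB//; [|exact: integrable_derive1M..].
  by apply: eq_Rintegral => x _; rewrite mulrBl.
by rewrite opprB opprK addrC.
Qed.

Lemma le_alex_norm f F x : is_primitive a b f F -> x \in `[a, b] ->
  `|F x| <= alex_norm a b f.
Proof.
move=> fF xab; have pF := primitiveE ab fF; rewrite -pF//.
apply: ub_le_sup; last by exists x.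
have [[cF _] _] := fF; have [A FA] := within_continuous_bounded ab cF.
by exists A => _ [y yab <-]; rewrite pF//; exact: FA.
Qed.

Lemma alex_norm_le f F e : is_primitive a b f F ->
  (forall x, x \in `[a, b] -> `|F x| <= e) -> alex_norm a b f <= e.
Proof.
move=> fF Fe; have pF := primitiveE ab fF.
apply: ge_sup.
  by exists `|primitive a b f a|; exists a => //=; rewrite in_itv/= lexx ltW.
by move=> _ [y yab <-]; rewrite pF//; exact: Fe.
Qed.

Lemma alex_norm_ge0 f F : is_primitive a b f F -> 0 <= alex_norm a b f.
Proof.
move=> fF; apply: le_trans (normr_ge0 (F a)) (le_alex_norm fF _).
by rewrite in_itv/= lexx ltW.
Qed.

End distributions.

(** * Primitives of Riemann-Liouville integrals of distributions *)

Section riemann_liouville.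
Context {R : realType}.
Variables (a b : R).
Hypothesis ab : a < b.
Local Notation mu := (@lebesgue_measure R).
Implicit Types (m n x e : R) (F G g : R -> R) (f h : distr R).

Lemma continuous_L1 F : {within `[a, b], continuous F} -> L1 a b F.
Proof.
by move=> cF; apply: continuous_compact_integrable => //; exact: segment_compact.
Qed.

(** The function $J^{n-1}F$ is continuous, hence integrable, so its regular distribution has
    primitive $J^1 J^{n-1} F = J^n F$. *)
Lemma is_primitive_RL_ge1 n f F : 1 <= n -> is_primitive a b f F ->
  is_primitive a b (regdist a b (RLfun a b n f)) (RLcl a n F).
Proof.
move=> n1 fF; have [CF _] := fF.
have n1' : 0 <= n - 1 by rewrite subr_ge0.
have [cJ _] := continuous_RLcl ab n1' CF.
have p1 := is_primitive_regdist ab (continuous_L1 cJ).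
have p2 : is_primitive a b (regdist a b (RLcl a (n - 1) F)) (RLcl a n F).
  apply: (is_primitive_eq ab p1) => x xab.
  by rewrite (RLcl_semigroup ab ler01 n1' CF xab) addrC subrK.
apply: is_primitive_distr_eq p2 _ => phi _.
by apply: eq_Rintegral => x; rewrite inE/= => xab; rewrite (RLfunE ab n1 fF xab).
Qed.

Section order_lt1.
Variables (n : R) (f : distr R) (F : R -> R).
Hypothesis n0 : 0 < n.
Hypothesis fF : is_primitive a b f F.

Let C : R := frac_kernel (n + 1) (b - a + 1).

(** The two compositions are exchanged through the order $1 + n \ge 1$, where the $L^1$ identity
    holds at every point. *)
Let is_primitive_RLcl_L1 g : L1 a b g ->
  is_primitive a b (regdist a b (RLcl a n g)) (RLcl a n (RLcl a 1 g)).
Proof.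
move=> ig; have n1 : 1 <= 1 + n by rewrite lerDl ltW.
apply: (is_primitive_eq ab (is_primitive_regdist ab (L1_RLcl ab n0 ig))) => x xab.
rewrite (RLcl_RLcl_L1 ab ltr01 n0 n1 xab ig).
by rewrite (RLcl_RLcl_L1 ab n0 ltr01 _ xab ig) 1?addrC.
Qed.

Let is_primitive_Ddistr_RLcl :
  is_primitive a b (Ddistr a b (RLcl a n F)) (RLcl a n F).
Proof. by have [CF _] := fF; split => //; apply: continuous_RLcl => //; exact: ltW. Qed.

Let alex_norm_RLcl g : L1 a b g ->
  alex_norm a b (distr_sub (regdist a b (RLcl a n g)) (Ddistr a b (RLcl a n F)))
    <= alex_norm a b (distr_sub (regdist a b g) f) * C.
Proof.
move=> ig; have [[cF _] _] := fF.
have [cG _] := in_C0_RLcl1 ab ig.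
have p1 := is_primitiveB (is_primitive_regdist ab ig) fF.
apply: (alex_norm_le ab (is_primitiveB (is_primitive_RLcl_L1 ig)
  is_primitive_Ddistr_RLcl)).
move=> x xab; apply: (RLcl_dist ab n0 xab).
- exact: within_continuous_measurable.
- exact: within_continuous_measurable.
- exact: within_continuous_bounded.
- exact: within_continuous_bounded.
- by move=> t tab; exact: (le_alex_norm ab p1 tab).
Qed.

(** Uniform approximation of [F] by indefinite integrals is Alexiewicz approximation of [f] by their
    integrands. *)
Let L1_approx : exists fk : nat -> R -> R, (forall k, L1 a b (fk k)) /\
  (fun k => alex_norm a b (distr_sub (regdist a b (fk k)) f)) @ \oo --> 0.
Proof.
have [CF _] := fF.
have H (k : nat) : exists g, L1 a b g /\
    alex_norm a b (distr_sub (regdist a b g) f) <= k.+1%:R^-1.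
  have k0 : 0 < k.+1%:R^-1 :> R by rewrite invr_gt0.
  have [g cg gF] := RLcl1_dense ab CF k0.
  have ig : L1 a b g by apply: continuous_L1; exact: continuous_subspaceT.
  exists g; split => //.
  by apply: (alex_norm_le ab (is_primitiveB (is_primitive_regdist ab ig) fF)).
have [fk Hfk] := choice H.
exists fk; split; first by move=> k; have [] := Hfk k.
apply: (@squeeze_cvgr _ _ _ _ (cst 0) (fun k : nat => k.+1%:R^-1)).
- near=> k; have [ig ->] := Hfk k.
  rewrite andbT.
  exact: (alex_norm_ge0 ab (is_primitiveB (is_primitive_regdist ab ig) fF)).
- exact: cvg_cst.
- exact: cvg_harmonic.
Unshelve. all: by end_near. Qed.

(* [RLlow] is only specified through limits along L^1 approximations of [f], so its
   value is identified by following one such sequence. *)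
Lemma is_primitive_RLlow : is_primitive a b (RLlow a b n f) (RLcl a n F).
Proof.
pose P h := DHK a b h /\
  forall fk : nat -> R -> R, (forall k, L1 a b (fk k)) ->
    (fun k => alex_norm a b (distr_sub (regdist a b (fk k)) f)) @ \oo --> 0 ->
    (fun k => alex_norm a b (distr_sub (regdist a b (RLcl a n (fk k))) h)) @ \oo --> 0.
(* The specification is satisfiable, so [xget] returns a distribution that meets it and not the
   default. *)
have P0 : P (Ddistr a b (RLcl a n F)).
  split; first exact: (is_primitive_DHK ab is_primitive_Ddistr_RLcl).
  move=> fk ifk cfk.
  apply: (@squeeze_cvgr _ _ _ _ (cst 0)
    (fun k => alex_norm a b (distr_sub (regdist a b (fk k)) f) * C)).
  - near=> k; rewrite alex_norm_RLcl// andbT.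
    exact: (alex_norm_ge0 ab (is_primitiveB (is_primitive_RLcl_L1 (ifk k))
      is_primitive_Ddistr_RLcl)).
  - exact: cvg_cst.
  - by rewrite -[X in _ --> X](mul0r C); apply: cvgM => //; exact: cvg_cst.
have [[_ [H hH]] Hcvg] : P (RLlow a b n f) by exact: (xgetPex _ (ex_intro _ _ P0)).
have [fk [ifk cfk]] := L1_approx.
have cvg1 := Hcvg fk ifk cfk; have cvg2 := P0.2 fk ifk cfk.
apply: (is_primitive_eq ab hH) => x xab.
apply/eqP; rewrite -subr_eq0 -normr_le0.
pose Jk k := regdist a b (RLcl a n (fk k)).
(* For each $k$ this sum bounds $|H(x) - J^nF(x)|$, by the triangle inequality through the primitive
   of $J^n f_k$. *)
have L : (fun k => alex_norm a b (distr_sub (Jk k) (RLlow a b n f)) +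
      alex_norm a b (distr_sub (Jk k) (Ddistr a b (RLcl a n F)))) @ \oo --> (0 : R).
  by rewrite -[X in _ --> X]addr0; exact: cvgD.
rewrite -(cvg_lim (@norm_hausdorff _ _) L); apply: limr_ge.
  by apply/cvg_ex; exists 0.
apply: nearW => k; have pk := is_primitive_RLcl_L1 (ifk k).
have h1 := le_alex_norm ab (is_primitiveB pk hH) xab.
have h2 := le_alex_norm ab (is_primitiveB pk is_primitive_Ddistr_RLcl) xab.
have -> : H x - RLcl a n F x =
    (RLcl a n (RLcl a 1 (fk k)) x - RLcl a n F x) -
    (RLcl a n (RLcl a 1 (fk k)) x - H x) by ring.
by apply: (le_trans (ler_normB _ _)); rewrite addrC lerD.
Unshelve. all: by end_near. Qed.

End order_lt1.

Lemma is_primitive_RL n f F : 0 <= n -> is_primitive a b f F ->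
  is_primitive a b (RL a b n f) (RLcl a n F).
Proof.
move=> n0 fF; rewrite /RL; have [->|nn0] := eqVneq n 0.
  by apply: (is_primitive_eq ab fF) => x _; rewrite RLcl0.
case: ifPn => n1; first exact: is_primitive_RL_ge1.
by apply: is_primitive_RLlow => //; rewrite lt_neqAle eq_sym nn0.
Qed.

Lemma RL_RL m n f : 0 <= m -> 0 <= n -> DHK a b f ->
  distr_eq a b (RL a b m (RL a b n f)) (RL a b (m + n) f).
Proof.
move=> m0 n0 [_ [F fF]]; have [CF _] := fF.
apply: (distr_eq_primitive (is_primitive_RL m0 (is_primitive_RL n0 fF))
  (is_primitive_RL (addr_ge0 m0 n0) fF)) => x xab.
exact: (RLcl_semigroup ab m0 n0 CF xab).
Qed.

Lemma RLC m n f : 0 <= m -> 0 <= n -> DHK a b f ->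
  distr_eq a b (RL a b m (RL a b n f)) (RL a b n (RL a b m f)).
Proof.
move=> m0 n0 Df phi tphi; rewrite (RL_RL m0 n0 Df tphi) (RL_RL n0 m0 Df tphi).
by rewrite addrC.
Qed.

Lemma DHK_RL n f : 0 <= n -> DHK a b f -> DHK a b (RL a b n f).
Proof.
by move=> n0 [_ [F fF]]; exact: (is_primitive_DHK ab (is_primitive_RL n0 fF)).
Qed.

End riemann_liouville.

Unset Implicit Arguments.

Theorem theorem3p4 (R : realType) (a b : R) (hab : a < b) :
  (* (i) *)
  (forall m n : R, 0 <= m -> 0 <= n -> forall f, DHK a b f ->
     distr_eq a b (RL a b m (RL a b n f)) (RL a b (m + n) f)
     /\ (1 <= m -> forall x, x \in `[a, b] ->
           RLfun a b m (RL a b n f) x = RLfun a b (m + n) f x)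
     /\ (1 <= n -> m < 1 -> forall x, x \in `[a, b] ->
           RLcl a m (RLfun a b n f) x = RLfun a b (m + n) f x))
  (* (ii) *)
  /\ (forall m n : R, 0 <= m -> 0 <= n -> forall f, DHK a b f ->
        distr_eq a b (RL a b m (RL a b n f)) (RL a b n (RL a b m f)))
  (* (iii) *)
  /\ ((forall n : R, 0 <= n -> forall f, DHK a b f -> DHK a b (RL a b n f))
      /\ (forall m n : R, 0 <= m -> 0 <= n -> exists p : R, 0 <= p /\
            forall f, DHK a b f ->
              distr_eq a b (RL a b m (RL a b n f)) (RL a b p f))
      /\ (forall m n : R, 0 <= m -> 0 <= n -> forall f, DHK a b f ->
            distr_eq a b (RL a b m (RL a b n f)) (RL a b n (RL a b m f)))
      /\ (forall n : R, 0 <= n -> forall f, DHK a b f ->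
            distr_eq a b (RL a b 0 (RL a b n f)) (RL a b n f)
            /\ distr_eq a b (RL a b n (RL a b 0 f)) (RL a b n f))).
Proof.
split.
  move=> m n m0 n0 f Df; split; first exact: RL_RL.
  have [_ [F fF]] := Df; have [CF _] := fF.
  split.
    (* At the level of primitives the claim is $J^{m-1}J^nF = J^{m+n-1}F$, an identity of continuous
       functions. *)
    move=> m1 x xab; have m1' : 0 <= m - 1 by rewrite subr_ge0.
    have mn1 : 1 <= m + n by rewrite (le_trans m1)// lerDl.
    rewrite (RLfunE hab m1 (is_primitive_RL hab n0 fF) xab) (RLfunE hab mn1 fF xab).
    by rewrite (RLcl_semigroup hab m1' n0 CF xab) addrAC.
  (* Here $J^n f$ is the continuous function $J^{n-1}F$, on which the outer operator acts as a
     classical integral. *)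
  move=> n1 _ x xab; have n1' : 0 <= n - 1 by rewrite subr_ge0.
  have mn1 : 1 <= m + n by rewrite (le_trans n1)// lerDr.
  rewrite (RLfunE hab mn1 fF xab).
  rewrite (eq_RLcl m xab (fun t tab => RLfunE hab n1 fF tab)).
  by rewrite (RLcl_semigroup hab m0 n1' CF xab) addrA.
split; first by move=> m n m0 n0 f; exact: RLC.
split; first by move=> n n0 f; exact: DHK_RL.
split.
  move=> m n m0 n0; exists (m + n); split; first exact: addr_ge0.
  by move=> f; exact: RL_RL.
split; first by move=> m n m0 n0 f; exact: RLC.
by move=> n n0 f Df; rewrite /RL eqxx.
Qed.
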